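(* Let $(R,\mathfrak m)$ be a local ring of dimension $d\ge1$. Suppose that $\{I_n\}_n$ is a graded family of $\mathfrak m$-primary ideals, and set $I_0=R$. Suppose there exists $A\in\mathbb{R}$ such that $$\ell(R/I_n)=\frac{A}{d!}n^d+O(n^{d-1}).$$ Then for every $x\in\mathbb{R}_{>0}$, $$c_{LM}^\infty(R)\ge\frac{A}{x^d\sum_{j=0}^\infty\ell(I_j/I_{j+1})e^{-jx}}.$$
   Context: All rings are commutative, Noetherian, with $1$. For a local ring $(R,\mathfrak m)$ of dimension $d$ and an $\mathfrak m$-primary ideal $I$, $\ell$ denotes length and $e(I)=\lim_{n\to\infty} d!\,\ell(R/I^n)/n^d$ is the Hilbert--Samuel multiplicity (the symbol $e$ in $e^{-jx}$ is the base of the natural logarithm). The Lech--Mumford constant is $c_{LM}(R)=\sup_{\sqrt I=\mathfrak m}\frac{e(I)}{d!\,\ell(R/I)}$. The sequence $c_{LM}(R[[T_1,\dots,T_n]])$ is non-increasing in $n$ and bounded below by $1$; set $c_{LM}^{\infty}(R)=\lim_{n\to\infty}c_{LM}(R[[T_1,\dots,T_n]])$. A graded family of ideals is a sequence $\{I_n\}_n$ with $I_{n+1}\subseteq I_n$ and $I_nI_m\subseteq I_{n+m}$ for all $n,m$. *)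

(* Defs.v *)
From HB Require Import structures.
From mathcomp Require Import all_boot all_order all_algebra.
From mathcomp Require Import all_classical all_reals all_analysis.
Import Order.TTheory GRing.Theory Num.Theory.
Import numFieldNormedType.Exports.

Set Implicit Arguments.
Unset Strict Implicit.
Unset Printing Implicit Defensive.

Local Open Scope classical_set_scope.
Local Open Scope ring_scope.

Section Ideals.
Variable R : comNzRingType.

(* [idealr_closed] of ring_quotient is not used because it is restricted to
   proper ideals, whereas the unit ideal is needed here. *)
Definition is_ideal (I : set R) : Prop :=
  [/\ I 0, forall a b, I a -> I b -> I (a + b) & forall r a, I a -> I (r * a)].

Definition is_prime_ideal (P : set R) : Prop :=
  [/\ is_ideal P, ~ P 1 & forall a b, P (a * b) -> P a \/ P b].

Definition is_maximal_ideal (M : set R) : Prop :=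
  [/\ is_ideal M, ~ M 1 &
      forall J, is_ideal J -> ~ J 1 -> M `<=` J -> J = M].

Definition ideal_gen (X : set R) : set R := smallest is_ideal X.

Definition ideal_mul (I J : set R) : set R :=
  ideal_gen [set z | exists a b, [/\ I a, J b & z = a * b]].

Definition ideal_pow (I : set R) (n : nat) : set R :=
  iter n (ideal_mul I) setT.

Definition radical (I : set R) : set R := [set a | exists n, I (a ^+ n)].

Definition noetherian : Prop :=
  forall I, is_ideal I -> exists s : seq R, I = ideal_gen [set` s].

Definition local_ring (m : set R) : Prop :=
  is_maximal_ideal m /\ forall m', is_maximal_ideal m' -> m' = m.

(* For [m] maximal, [radical I = m] already forces [I] to be primary. *)
Definition m_primary (m I : set R) : Prop := is_ideal I /\ radical I = m.

(* Lengths [n] of the strict chains [c 0 `<` ... `<` c n] of members of [F]. *)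
Definition chain_lengths (F : set (set R)) : set nat :=
  [set n | exists c : nat -> set R,
     (forall i, (i <= n)%N -> F (c i)) /\
     (forall i, (i < n)%N -> c i `<` c i.+1)].

Definition has_krull_dim (d : nat) : Prop :=
  chain_lengths is_prime_ideal d /\
  forall n, chain_lengths is_prime_ideal n -> (n <= d)%N.

(* Equal to 0 by convention when the dimension is infinite, which does not
   happen for Noetherian local rings. *)
Definition krull_dim : nat := xget 0%N has_krull_dim.

(* Length of the [R]-module [J / I], for ideals [I `<=` J]: the submodules of
   [J / I] are the [L / I] with [L] an ideal between [I] and [J]. *)
Definition quot_length (K : realType) (J I : set R) : \bar K :=
  ereal_sup [set n%:R%:E | n in
    chain_lengths [set L | [/\ is_ideal L, I `<=` L & L `<=` J]]].

Definition hs_multiplicity (K : realType) (I : set R) : \bar K :=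
  limn (fun n : nat =>
    (krull_dim`!%:R%:E * quot_length K setT (ideal_pow I n)
       / (n%:R ^+ krull_dim)%:E)%E).

(* The maximal ideal is quantified inside the supremum, so that the constant
   depends on the ring only; for a local ring it is unique. *)
Definition c_LM (K : realType) : \bar K :=
  ereal_sup [set (hs_multiplicity K I
                    / (krull_dim`!%:R%:E * quot_length K setT I))%E | I in
    [set I | exists m, local_ring m /\ m_primary m I]].

(* The index 0 is included; by convention the ideal there is the whole ring. *)
Definition graded_family (I : nat -> set R) : Prop :=
  (forall n, I n.+1 `<=` I n) /\
  (forall n k, ideal_mul (I n) (I k) `<=` I (n + k)%N).

End Ideals.

Arguments noetherian R : clear implicits.
Arguments has_krull_dim R d : clear implicits.
Arguments krull_dim R : clear implicits.
Arguments c_LM R K : clear implicits.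

(* Power series in one variable, as coefficient sequences; the additive
   structure is pointwise and the product is the Cauchy product. *)
Definition pseries (R : comNzRingType) : Type := nat -> R.

HB.instance Definition _ (R : comNzRingType) :=
  GRing.Zmodule.copy (pseries R) (nat -> R).

Section PSeriesRing.
Variable R : comNzRingType.
Implicit Types f g h : pseries R.

Definition pseries_one : pseries R := fun n => (n == 0%N)%:R.

Definition pseries_mul f g : pseries R :=
  fun n => \sum_(i < n.+1) f i * g (n - i)%N.

Let trunc n f : {poly R} := \poly_(i < n.+1) f i.

Let truncE n f i : (i <= n)%N -> (trunc n f)`_i = f i.
Proof. by move=> le_in; rewrite coef_poly ltnS le_in. Qed.

Let mul_coef n (p q : {poly R}) f g :
    (forall i, (i <= n)%N -> p`_i = f i) ->
    (forall i, (i <= n)%N -> q`_i = g i) ->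
  forall i, (i <= n)%N -> (p * q)`_i = pseries_mul f g i.
Proof.
move=> pf qg i le_in; rewrite coefM; apply: eq_bigr => j _.
rewrite pf ?qg //; first exact: leq_trans (leq_subr _ _) le_in.
by apply: leq_trans le_in; rewrite -ltnS.
Qed.

Let pseries_mulA : associative pseries_mul.
Proof.
move=> f g h; apply/funext => n.
have T k := truncE (n := n) k.
rewrite -(mul_coef (T f) (mul_coef (T g) (T h)) (leqnn n)).
by rewrite -(mul_coef (mul_coef (T f) (T g)) (T h) (leqnn n)) mulrA.
Qed.

Let pseries_mulC : commutative pseries_mul.
Proof.
move=> f g; apply/funext => n; have T k := truncE (n := n) k.
rewrite -(mul_coef (T f) (T g) (leqnn n)).
by rewrite -(mul_coef (T g) (T f) (leqnn n)) mulrC.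
Qed.

Let pseries_mul1 : left_id pseries_one pseries_mul.
Proof.
move=> f; apply/funext => n; rewrite /pseries_mul big_ord_recl /pseries_one /=.
rewrite mul1r subn0 big1 ?addr0 // => i _.
by rewrite mul0r.
Qed.

Let pseries_mulDl : left_distributive pseries_mul +%R.
Proof.
move=> f g h; apply/funext => n.
transitivity (pseries_mul f h n + pseries_mul g h n) => //.
by rewrite -big_split; apply: eq_bigr => i _; exact: mulrDl.
Qed.

Let pseries_one_neq0 : pseries_one != 0 :> pseries R.
Proof.
apply/eqP => /(congr1 (fun f : pseries R => f 0%N)) /eqP.
by rewrite /pseries_one /= (_ : (0 : pseries R) 0%N = 0) // oner_eq0.
Qed.

HB.instance Definition _ := GRing.Zmodule_isComNzRing.Build (pseries R)
  pseries_mulA pseries_mulC pseries_mul1 pseries_mulDl pseries_one_neq0.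

End PSeriesRing.

(* R[[T_1, ..., T_n]], as R[[T_1, ..., T_(n-1)]][[T_n]]. *)
Fixpoint mpseries (R : comNzRingType) (n : nat) : comNzRingType :=
  if n is k.+1 then pseries (mpseries R k) else R.

Definition c_LM_infty (R : comNzRingType) (K : realType) : \bar K :=
  limn (fun n : nat => c_LM (mpseries R n) K).

(* Main.v *)
(* Give the variables weight 1/w: in R[[T_1, ..., T_n]], let J_k be the ideal of
   the series whose coefficient at T^a lies in I_j for j = ceil((k - |a|) / w).
   These ideals form a graded family, and their colengths are the n-fold
   iterated sums of the colengths of the I_j. As J_k^t is contained in J_(kt),
   the multiplicity of J_k is at least (A / w^d) k^(d + n). For k = N w and w
   large, the colength of J_k is at most about
   (w^n / n!) \sum_(i < N) l(I_i / I_(i+1)) (N - i)^n. With N about n / x and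
   (1 - i / N)^n <= exp (- i n / N), this bounds c_LM (R[[T_1, ..., T_n]]) from
   below, and n -> oo gives the claim.

   The limit exists since c_LM (R[[T]]) <= c_LM R: following Mumford, an ideal J
   of R[[T]] is compared with its leading coefficient ideals J_i, which satisfy
   l(R[[T]] / J) = \sum_i l(R / J_i) and e(J) <= (d + 1) \sum_i e(J_i).

   That multiplicities are limits is Hilbert's theorem: filtering I^k / I^(k+1)
   by the monomials in generators of I, ordered lexicographically, its length is
   a sum over exponent vectors of a function that stabilizes in each direction.
   The same filtration gives Artin-Rees, hence the bound of chains of primes by
   the growth of colengths; with a system of parameters of R this yields
   dim R[[T]] = dim R + 1. *)
Require Import Defs.
From HB Require Import structures.
From mathcomp Require Import all_boot all_order all_algebra.
From mathcomp Require Import all_classical all_reals all_analysis.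
From mathcomp Require Import ring lra zify.
Import Order.TTheory GRing.Theory Num.Theory.
Import numFieldNormedType.Exports.

Set Implicit Arguments.
Unset Strict Implicit.
Unset Printing Implicit Defensive.

Local Open Scope classical_set_scope.
Local Open Scope ring_scope.

(** * Operations on ideals *)

(** Two facts must precede any estimate. [hs_multiplicity] and [c_LM_infty] are values of [limn], so
    they can be compared with anything only once convergence is known; and the factorials and
    exponents in [c_LM (mpseries R n)] come from [krull_dim], so the dimension has to be exactly
    [n + d]. Convergence is taken in [\bar K]: an infinite Lech-Mumford constant only makes the
    bound at hand trivial. The weight [1/w] turns lattice points into volumes: the colengths count
    lattice points in simplices, and enlarging these by [w] brings the count close to
    [w^n (N - i)^n / n!]. The choice [w = n^3] makes the total loss at most a factor [1 - 1/n]. The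
    error term of the colengths is not carried through the [n] summations as it stands. Lowering [A]
    to some [a < A] leaves a constant error [B], which the summations turn into at most [B k^n];
    this is negligible against [k^(n + d)] because [d >= 1]. Letting [a] approach [A] is the last
    step. *)

Section IdealOps.
Variable R : comNzRingType.
Implicit Types (I J K G L P m : set R) (s : seq R).

Lemma ideal0 I : is_ideal I -> I 0. Proof. by case. Qed.

Lemma idealD I a b : is_ideal I -> I a -> I b -> I (a + b).
Proof. by case=> _ h _; exact: h. Qed.

Lemma idealMl I r a : is_ideal I -> I a -> I (r * a).
Proof. by case=> _ _; exact. Qed.

Lemma idealMr I r a : is_ideal I -> I a -> I (a * r).
Proof. by rewrite mulrC; exact: idealMl. Qed.

Lemma idealN I a : is_ideal I -> I a -> I (- a).
Proof. by rewrite -mulN1r; exact: idealMl. Qed.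

Lemma idealB I a b : is_ideal I -> I a -> I b -> I (a - b).
Proof. by move=> Ii Ia Ib; apply: idealD => //; exact: idealN. Qed.

Lemma ideal_sum I (T : Type) (r : seq T) (F : T -> R) :
  is_ideal I -> (forall i, I (F i)) -> I (\sum_(i <- r) F i).
Proof.
move=> Ii IF; elim/big_ind : _ => [|x y|//]; first exact: ideal0.
exact: idealD.
Qed.

Lemma ideal1 I : is_ideal I -> I 1 -> I = setT.
Proof.
move=> Ii I1; apply/seteqP; split=> // x _.
by rewrite -(mulr1 x); exact: idealMl.
Qed.

Lemma idealT : is_ideal (@setT R). Proof. by []. Qed.

Lemma ideal_set0 : is_ideal [set (0 : R)].
Proof.
split=> [//|a b -> ->|r a ->]; first by rewrite addr0.
by rewrite mulr0.
Qed.

Lemma idealI I J : is_ideal I -> is_ideal J -> is_ideal (I `&` J).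
Proof.
move=> Ii Ji; split; first by split; exact: ideal0.
  by move=> a b [? ?] [? ?]; split; exact: idealD.
by move=> r a [? ?]; split; exact: idealMl.
Qed.

Definition isum I J : set R := [set x | exists2 a, I a & J (x - a)].

Lemma isum_ideal I J : is_ideal I -> is_ideal J -> is_ideal (isum I J).
Proof.
move=> Ii Ji; split; first by exists 0; [exact: ideal0|rewrite subr0; exact: ideal0].
- move=> x y [a Ia Ja] [b Ib Jb]; exists (a + b); first exact: idealD.
  by rewrite opprD addrACA; exact: idealD.
- move=> r x [a Ia Ja]; exists (r * a); first exact: idealMl.
  by rewrite -mulrBr; exact: idealMl.
Qed.

Lemma isum_l I J : is_ideal J -> I `<=` isum I J.
Proof. by move=> Ji x Ix; exists x => //; rewrite subrr; exact: ideal0. Qed.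

Lemma isum_r I J : is_ideal I -> J `<=` isum I J.
Proof. by move=> Ii x Jx; exists 0; [exact: ideal0|rewrite subr0]. Qed.

Lemma isum_min I J L : is_ideal L -> I `<=` L -> J `<=` L -> isum I J `<=` L.
Proof.
move=> Li IL JL x [a Ia Ja]; rewrite -(subrK a x) addrC.
by apply: idealD => //; [exact: IL|exact: JL].
Qed.

Lemma isum_mono I I' J J' : I `<=` I' -> J `<=` J' -> isum I J `<=` isum I' J'.
Proof. by move=> II JJ x [a Ia Ja]; exists a; [exact: II|exact: JJ]. Qed.

(* The ideal [G + (z)]. *)
Definition adj (z : R) G : set R := [set x | exists c, G (x - c * z)].

Lemma adj_ideal z G : is_ideal G -> is_ideal (adj z G).
Proof.
move=> Gi; split; first by exists 0; rewrite mul0r subr0; exact: ideal0.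
- move=> x y [a Ga] [b Gb]; exists (a + b).
  by rewrite mulrDl opprD addrACA; exact: idealD.
- move=> r x [a Ga]; exists (r * a).
  by rewrite -mulrA -mulrBr; exact: idealMl.
Qed.

Lemma adj_sub z G : G `<=` adj z G.
Proof. by move=> x Gx; exists 0; rewrite mul0r subr0. Qed.

Lemma adj_mem z G : is_ideal G -> adj z G z.
Proof. by move=> Gi; exists 1; rewrite mul1r subrr; exact: ideal0. Qed.

Lemma adj_min z G L : is_ideal L -> L z -> G `<=` L -> adj z G `<=` L.
Proof.
move=> Li Lz GL x [c Gc]; rewrite -(subrK (c * z) x).
by apply: idealD => //; [exact: GL|exact: idealMl].
Qed.

Lemma adj_mono z G L : G `<=` L -> adj z G `<=` adj z L.
Proof. by move=> GL x [c Gc]; exists c; exact: GL. Qed.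

(** Generators are adjoined one at a time so that consecutive quotients are cyclic and [len_adj]
    computes them. The base [G] is [[set 0]] for a generated ideal, and a power of an ideal in the
    filtrations below. *)
Definition span G s : set R := foldr adj G s.

Lemma span_ideal G s : is_ideal G -> is_ideal (span G s).
Proof. by move=> Gi; elim: s => //= z s; exact: adj_ideal. Qed.

Lemma span_sub G s : G `<=` span G s.
Proof. by elim: s => //= z s IH x /IH; exact: adj_sub. Qed.

Lemma span_mem G s z : is_ideal G -> z \in s -> span G s z.
Proof.
move=> Gi; elim: s => //= y s IH; rewrite in_cons => /orP[/eqP ->|/IH].
  by apply: adj_mem; exact: span_ideal.
exact: adj_sub.
Qed.

Lemma span_min G s L : is_ideal L -> {in s, forall z, L z} -> G `<=` L ->
  span G s `<=` L.
Proof.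
move=> Li; elim: s => //= z s IH Ls GL; apply: adj_min => //.
  by apply: Ls; rewrite inE eqxx.
by apply: IH => // y ys; apply: Ls; rewrite inE ys orbT.
Qed.

Lemma span_mono G s L t : is_ideal L -> G `<=` L -> {subset s <= t} ->
  span G s `<=` span L t.
Proof.
move=> Li GL st; apply: span_min => [|z zs|]; first exact: span_ideal.
- by apply: span_mem => //; exact: st.
- by apply: subset_trans GL _; exact: span_sub.
Qed.

Lemma ideal_gen_ideal (X : set R) : is_ideal (ideal_gen X).
Proof.
split.
- by move=> L [Li _]; exact: ideal0.
- by move=> a b ha hb L XL; apply: idealD (ha _ XL) (hb _ XL); case: XL.
- by move=> r a ha L XL; apply: idealMl (ha _ XL); case: XL.
Qed.

Lemma ideal_gen_span s : ideal_gen [set` s] = span [set 0] s.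
Proof.
apply/seteqP; split.
  apply: smallest_sub; first exact: span_ideal ideal_set0.
  by move=> z /= zs; exact: span_mem ideal_set0 zs.
apply: span_min; first exact: ideal_gen_ideal.
- by move=> z zs L [_]; apply.
- by move=> _ ->; exact: ideal0 (ideal_gen_ideal _).
Qed.

Lemma ideal_mul_ideal I J : is_ideal (ideal_mul I J).
Proof. exact: ideal_gen_ideal. Qed.

Lemma ideal_mul_mem I J a b : I a -> J b -> ideal_mul I J (a * b).
Proof. by move=> Ia Jb; apply: sub_gen_smallest; exists a, b. Qed.

Lemma ideal_mul_min I J L : is_ideal L ->
  (forall a b, I a -> J b -> L (a * b)) -> ideal_mul I J `<=` L.
Proof.
move=> Li h; apply: smallest_sub => // z [a [b [Ia Jb ->]]]; exact: h.
Qed.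

Lemma ideal_mul_subr I J : is_ideal J -> ideal_mul I J `<=` J.
Proof. by move=> Ji; apply: ideal_mul_min => // a b _; exact: idealMl. Qed.

Lemma ideal_mul_subl I J : is_ideal I -> ideal_mul I J `<=` I.
Proof. by move=> Ii; apply: ideal_mul_min => // a b Ia _; exact: idealMr. Qed.

Lemma ideal_pow_ideal I n : is_ideal (ideal_pow I n).
Proof. by case: n => [|n]; [exact: idealT|exact: ideal_mul_ideal]. Qed.

Lemma ideal_powS I n : ideal_pow I n.+1 = ideal_mul I (ideal_pow I n).
Proof. by []. Qed.

Lemma ideal_pow_sub I n k : (n <= k)%N -> ideal_pow I k `<=` ideal_pow I n.
Proof.
move=> /subnK <-; elim: (k - n)%N => // j IH; rewrite addSn ideal_powS.
by apply: subset_trans IH; apply: ideal_mul_subr; exact: ideal_pow_ideal.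
Qed.

Lemma ideal_pow1 I : is_ideal I -> ideal_pow I 1 = I.
Proof.
move=> Ii; apply/seteqP; split; first exact: ideal_mul_subl.
by move=> x Ix; rewrite -(mulr1 x); exact: ideal_mul_mem.
Qed.

Lemma ideal_pow_mem I a n : I a -> ideal_pow I n (a ^+ n).
Proof. by move=> Ia; elim: n => // n IH; rewrite exprS; exact: ideal_mul_mem. Qed.

Lemma ideal_powD I n k a b : ideal_pow I n a -> ideal_pow I k b ->
  ideal_pow I (n + k) (a * b).
Proof.
move=> ha hb; elim: n a ha => [a _|n IH a].
  by apply: idealMl => //; exact: ideal_pow_ideal.
rewrite addSn !ideal_powS; move: a.
apply: (@ideal_mul_min _ _ [set a | ideal_mul I (ideal_pow I (n + k)) (a * b)]).
  split=> /=; first by rewrite mul0r; exact: ideal0 (ideal_mul_ideal _ _).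
  - move=> x y hx hy; rewrite mulrDl; exact: idealD (ideal_mul_ideal _ _) _ _.
  - move=> r x hx; rewrite -mulrA; exact: idealMl (ideal_mul_ideal _ _) _.
move=> x y Ix hy /=; rewrite -mulrA; apply: ideal_mul_mem => //; exact: IH.
Qed.

Lemma ideal_pow_setT n : ideal_pow (@setT R) n = setT.
Proof.
apply: ideal1 (ideal_pow_ideal _ _) _.
by rewrite -(expr1n R n); exact: ideal_pow_mem.
Qed.

Definition colon G (z : R) : set R := [set c | G (c * z)].

Lemma colon_ideal G z : is_ideal G -> is_ideal (colon G z).
Proof.
move=> Gi; split; rewrite /colon /=; first by rewrite mul0r; exact: ideal0.
- by move=> a b ha hb; rewrite mulrDl; exact: idealD.
- by move=> r a ha; rewrite -mulrA; exact: idealMl.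
Qed.

End IdealOps.

(** * Length *)

(** Strictly increasing maps carry strict chains to strict chains. Used in both directions, this
    transfers lengths between different rings without any module isomorphism. *)
Lemma chain_lengths_map (S T : comNzRingType) (F : set (set S)) (F' : set (set T))
    (phi : set S -> set T) :
    (forall L, F L -> F' (phi L)) ->
    (forall L L', F L -> F L' -> L `<` L' -> phi L `<` phi L') ->
  chain_lengths F `<=` chain_lengths F'.
Proof.
move=> FF' mono n [c [cF cS]]; exists (phi \o c); split=> [i le_in|i lt_in].
  by apply: FF'; exact: cF.
by apply: mono; [exact: cF (ltnW _)|exact: cF|exact: cS].
Qed.

Section Length.
Variable R : comNzRingType.
Implicit Types (I J K G L : set R).

Definition between J I : set (set R) :=
  [set L | [/\ is_ideal L, I `<=` L & L `<=` J]].

Definition flen J I := exists N, forall n, chain_lengths (between J I) n -> (n <= N)%N.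

Definition max_chain_length (F : set (set R)) (n : nat) :=
  chain_lengths F n /\ forall k, chain_lengths F k -> (k <= n)%N.

(** A natural number, with the value 0 when chain lengths are unbounded; this is why [flen]
    accompanies it. *)
Definition len J I : nat := xget 0%N (max_chain_length (between J I)).

Lemma chain_lengths_refl J I : is_ideal I -> I `<=` J ->
  chain_lengths (between J I) 0.
Proof.
by move=> Ii IJ; exists (fun=> I); split=> [i _|i]; [split|rewrite ltn0].
Qed.

Lemma lenP J I : is_ideal I -> I `<=` J -> flen J I ->
  max_chain_length (between J I) (len J I).
Proof.
move=> Ii IJ [N bN]; rewrite /len; case: xgetP => [n _ //|no].
exfalso.
have ex0 : exists n, `[< chain_lengths (between J I) n >].
  by exists 0%N; apply/asboolP; exact: chain_lengths_refl.
have ub n : `[< chain_lengths (between J I) n >] -> (n <= N)%N.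
  by move=> /asboolP; exact: bN.
case: (ex_maxnP ex0 ub) => n /asboolP cn mx.
by apply: (no n); split=> // k ck; apply: mx; apply/asboolP.
Qed.

Lemma len_eq J I n : max_chain_length (between J I) n -> len J I = n.
Proof.
move=> [cn mx]; rewrite /len; case: xgetP => [k _ [ck mk]|/(_ n)[]//].
by apply/eqP; rewrite eqn_leq mx// mk.
Qed.

Lemma quot_lengthE (K : realType) J I : is_ideal I -> I `<=` J -> flen J I ->
  quot_length K J I = (len J I)%:R%:E.
Proof.
move=> Ii IJ fl; have [cl mx] := lenP Ii IJ fl.
apply/eqP; rewrite eq_le; apply/andP; split.
  by apply: ge_ereal_sup => _ [n cn <-]; rewrite lee_fin ler_nat; exact: mx.
by apply: ereal_sup_ubound; exists (len J I).
Qed.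

Lemma flen_chain J I : is_ideal I -> I `<=` J -> flen J I ->
  forall n, chain_lengths (between J I) n -> (n <= len J I)%N.
Proof. by move=> Ii IJ fl; case: (lenP Ii IJ fl). Qed.

Lemma flen_sub J I J' I' : I' `<=` I -> J `<=` J' -> flen J' I' -> flen J I.
Proof.
move=> II JJ [N bN]; exists N => n [c [cF cS]]; apply: bN; exists c; split=> // i /cF [? IL LJ].
by split=> //; [exact: subset_trans II IL|exact: subset_trans LJ JJ].
Qed.

(** A longest chain from [I] to [L] is lengthened by [J]. *)
Lemma len_lt J I L : is_ideal I -> I `<=` L -> is_ideal L -> is_ideal J ->
  L `<` J -> flen J I -> (len L I < len J I)%N.
Proof.
move=> Ii IL Li Ji LJ fl.
have [_ LJ'] := LJ; have [LsJ _] := LJ.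
have [[c [cF cS]] _] := lenP Ii IL (flen_sub (@subset_refl _ I) LsJ fl).
apply: (flen_chain Ii (subset_trans IL LsJ) fl).
exists (fun i => if (i <= len L I)%N then c i else J); split=> [i _|i].
  case: ifP => [/cF [? ? cL]|_]; first by split=> //; exact: subset_trans LsJ.
  by split=> //; exact: subset_trans LsJ.
rewrite ltnS => le_i; have := le_i; rewrite {1}leq_eqVlt => /orP[/eqP ->|lti]; last by rewrite lti (ltnW lti); exact: cS.
rewrite leqnn ltnn; have [_ _ cL] := cF _ (leqnn (len L I)).
split; first exact: subset_trans LsJ.
by move=> Jc; apply: LJ'; exact: subset_trans cL.
Qed.

Lemma len_refl I : is_ideal I -> len I I = 0%N.
Proof.
move=> Ii; apply: len_eq; split; first exact: chain_lengths_refl.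
move=> [//|k] [c [cF cS]]; have [_ h0] := cS 0%N isT; exfalso; apply: h0.
have [_ Ic _] := cF 0%N isT; have [_ _ cI] := cF 1%N isT.
exact: subset_trans Ic.
Qed.

(** Along a chain [c] from [I] to [K], the sum [f i] of the lengths of [(c i + J) / J] and
    [(c i & J) / I] strictly increases, which bounds the length of the chain. Equality comes from
    concatenating two longest chains. *)
Lemma len_additive I J K : is_ideal I -> is_ideal J -> is_ideal K ->
    I `<=` J -> J `<=` K -> flen K J -> flen J I ->
  flen K I /\ len K I = (len K J + len J I)%N.
Proof.
move=> Ii Ji Ki IJ JK flKJ flJI.
have ub n : chain_lengths (between K I) n -> (n <= len K J + len J I)%N.
  move=> [c [cF cS]].
  pose f i := (len (isum (c i) J) J + len (c i `&` J) I)%N.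
  have fb i : (i <= n)%N -> (f i <= len K J + len J I)%N.
    move=> le_in; have [ci Ic cK] := cF _ le_in; apply: leq_add.
      have [ -> //|ne] := pselect (isum (c i) J = K).
      apply: ltnW; apply: len_lt => //; [exact: isum_r|exact: isum_ideal|].
      have sK : isum (c i) J `<=` K by apply: isum_min.
      by split=> // Ks; apply: ne; apply/seteqP.
    have [ -> //|ne] := pselect (c i `&` J = J).
    apply: ltnW; apply: len_lt => //; [by move=> x Ix; split; [exact: Ic|exact: IJ]
      |exact: idealI|].
    by split=> [x []//|h]; apply: ne; apply/seteqP; split=> [x []|].
  have fS i : (i < n)%N -> (f i < f i.+1)%N.
    move=> lt_in; have [ci Ic cK] := cF _ (ltnW lt_in).
    have [ci' Ic' cK'] := cF _ lt_in; have [cc cc'] := cS _ lt_in.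
    have flb L : is_ideal L -> L `<=` K -> flen (isum L J) J.
      by move=> Li LK; apply: flen_sub flKJ => //; exact: isum_min.
    have fla L : flen (L `&` J) I by apply: flen_sub flJI => // x [].
    have les : (len (isum (c i) J) J <= len (isum (c i.+1) J) J)%N.
      have [ -> //|ne] := pselect (isum (c i) J = isum (c i.+1) J).
      apply: ltnW; apply: len_lt; [exact: Ji|exact: isum_r|exact: isum_ideal
      |exact: isum_ideal| |exact: flb].
      have ss : isum (c i) J `<=` isum (c i.+1) J by apply: isum_mono.
      by split=> // h; apply: ne; apply/seteqP.
    (* Modular law: if the traces on [J] agree, the sums with [J] must differ, for otherwise
       [c i.+1] would lie in [c i]. *)
    have [e|ne] := pselect (c i `&` J = c i.+1 `&` J); last first.
      rewrite /f -addnS; apply: leq_add => //.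
      apply: len_lt => //; [by move=> x Ix; split; [exact: Ic|exact: IJ]
        |exact: idealI|exact: idealI|].
      have ss : c i `&` J `<=` c i.+1 `&` J by move=> x [/cc].
      by split=> // h; apply: ne; apply/seteqP.
    rewrite /f e ltn_add2r; apply: len_lt; [exact: Ji|exact: isum_r|exact: isum_ideal
      |exact: isum_ideal| |exact: flb].
    split; first exact: isum_mono.
    move=> h; apply: cc' => x cx.
    have [a ca Ja] := h _ (isum_l Ji cx).
    have : (c i.+1 `&` J) (x - a) by split=> //; apply: idealB => //; exact: cc.
    by rewrite -e => -[cxa _]; rewrite -(subrK a x); exact: idealD.
  have fi i : (i <= n)%N -> (i <= f i)%N.
    elim: i => // i IH lt_in; exact: leq_ltn_trans (IH (ltnW lt_in)) (fS _ lt_in).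
  exact: leq_trans (fi _ (leqnn n)) (fb _ (leqnn n)).
have fl : flen K I by exists (len K J + len J I)%N.
split=> //; apply: len_eq; split=> //.
have [[c [cF cS]] _] := lenP Ji JK flKJ.
have [[b [bF bS]] _] := lenP Ii IJ flJI.
exists (fun i => if (i < len J I)%N then b i else c (i - len J I)%N); split=> [i le_i|i lt_i].
  case: ltnP => h.
    have [? ? bJ] := bF _ (ltnW h); split=> //; exact: subset_trans JK.
  have [|? Jc ?] := cF (i - len J I)%N; first by rewrite leq_subLR addnC.
  by split=> //; exact: subset_trans Jc.
case: (ltnP i.+1) => h.
  by rewrite (ltnW h); apply: bS; exact: ltnW.
move: h; rewrite leq_eqVlt => /orP[/eqP e|h].
  (* At the junction the chain passes from [b i] to [c 0], skipping [b i.+1]; the step is strict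
     because [b i.+1] lies in [J], hence in [c 0]. *)
  rewrite e ltnSn subnn.
  have [_ _ bJ] := bF _ (leqnn (len J I)); have [_ Jc _] := cF _ (leq0n _).
  have [bb bb'] : b i `<` b i.+1 by apply: bS; rewrite e.
  rewrite e in bJ.
  split; first by apply: subset_trans bb _; exact: subset_trans Jc.
  by move=> cb; apply: bb'; apply: subset_trans bJ _; exact: subset_trans cb.
rewrite ltnS in h; rewrite ltnNge h /= subSn//; apply: cS.
by rewrite ltn_subLR// addnC.
Qed.

Lemma len_add I J K : is_ideal I -> is_ideal J -> is_ideal K ->
  I `<=` J -> J `<=` K -> flen K I -> len K I = (len K J + len J I)%N.
Proof.
move=> Ii Ji Ki IJ JK fl.
have [] // := @len_additive I J K Ii Ji Ki IJ JK; first exact: flen_sub fl.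
exact: flen_sub fl.
Qed.

Lemma len_antitone I J K : is_ideal I -> is_ideal J -> is_ideal K ->
  I `<=` J -> J `<=` K -> flen K I -> (len K J <= len K I)%N.
Proof. by move=> Ii Ji Ki IJ JK fl; rewrite (len_add Ii Ji Ki)// leq_addr. Qed.

Lemma len_gt0 I J : is_ideal I -> is_ideal J -> I `<` J -> flen J I -> (0 < len J I)%N.
Proof.
move=> Ii Ji IJ fl; rewrite -(len_refl Ii); apply: len_lt => //.
Qed.

End Length.

(** * Comparison of lengths across quotients and ring maps *)

Section LengthTransfer.

Lemma len_transfer (S T : comNzRingType) (A B : set S) (C D : set T) :
    chain_lengths (between B A) = chain_lengths (between D C) ->
  (flen B A <-> flen D C) /\ len B A = len D C.
Proof. by rewrite /flen /len /max_chain_length => ->. Qed.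

(* Multiplication by [z] identifies [R / (G : z)] with [(G + (z)) / G]. *)
Lemma len_adj (R : comNzRingType) (G : set R) (z : R) : is_ideal G ->
  (flen (adj z G) G <-> flen setT (colon G z)) /\
  len (adj z G) G = len setT (colon G z).
Proof.
move=> Gi; apply: len_transfer; apply/seteqP; split.
  apply: (chain_lengths_map (phi := fun L => colon L z)).
    move=> L [Li GL LF]; split=> //; first exact: colon_ideal.
    by move=> c; exact: GL.
  move=> L L' [Li GL LF] [Li' GL' LF'] [LL' nLL']; split=> [c|h]; first exact: LL'.
  apply: nLL' => x L'x; have [c Gc] := LF' _ L'x.
  have : colon L' z c.
    by rewrite /colon /= -(subKr x (c * z)); apply: idealB => //; exact: GL'.
  move=> /h; rewrite /colon /= => Lc; rewrite -(subrK (c * z) x).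
  by apply: idealD => //; exact: GL.
apply: (chain_lengths_map (phi := fun M => [set x | exists2 c, M c & G (x - c * z)])).
  move=> M [Mi GM _]; split.
  - split; first by exists 0; [exact: ideal0|rewrite mul0r subr0; exact: ideal0].
    + move=> x y [a Ma Ga] [b Mb Gb]; exists (a + b); first exact: idealD.
      by rewrite mulrDl opprD addrACA; exact: idealD.
    + move=> r x [a Ma Ga]; exists (r * a); first exact: idealMl.
      by rewrite -mulrA -mulrBr; exact: idealMl.
  - by move=> x Gx; exists 0; [exact: ideal0|rewrite mul0r subr0].
  - by move=> x [c _ Gc]; exists c.
move=> M M' [Mi GM _] [Mi' GM' _] [MM' nMM']; split.
  by move=> x [c Mc Gc]; exists c => //; exact: MM'.
move=> h; apply: nMM' => c M'c.
have [|c' Mc' Gc'] := h (c * z); first by exists c => //; rewrite subrr; exact: ideal0.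
rewrite -(subrK c' c); apply: idealD => //; apply: GM.
by rewrite /colon /= mulrBl.
Qed.

(** Correspondence of ideals under a surjection. The section [q] is merely a map of sets: an ideal
    containing the kernel of [p] contains [x] exactly when it contains [q (p x)]. *)
Lemma len_surj (S T : comNzRingType) (p : S -> T) (q : T -> S) (I : set T) :
    p 0 = 0 -> {morph p : x y / x + y} -> {morph p : x y / x * y} -> cancel q p ->
    is_ideal I ->
  is_ideal (p @^-1` I) /\
  ((flen setT (p @^-1` I) <-> flen setT I) /\ len setT (p @^-1` I) = len setT I).
Proof.
move=> p0 pD pM qK Ii.
have pi L : is_ideal L -> is_ideal (p @^-1` L).
  move=> Li; split=> /=; first by rewrite p0; exact: ideal0.
  - by move=> a b ha hb; rewrite pD; exact: idealD.
  - by move=> r a ha; rewrite pM; exact: idealMl.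
split; first exact: pi.
have ker L x : is_ideal L -> p @^-1` I `<=` L -> L x <-> L (q (p x)).
  move=> Li IL.
  have pN y : p (- y) = - p y.
    by apply/eqP; rewrite -addr_eq0 -pD addNr p0.
  have Lx : L (x - q (p x)).
    by apply: IL; rewrite /= pD pN qK subrr; exact: ideal0.
  split=> h; first by rewrite -(subKr x (q (p x))); exact: idealB.
  by rewrite -(subrK (q (p x)) x); exact: idealD.
apply: len_transfer; apply/seteqP; split.
  apply: (chain_lengths_map (phi := fun L => [set y | L (q y)])).
    move=> L [Li IL _].
    have kerp y z : p z = y -> L z -> L (q y) by move=> <- /(ker _ _ Li IL).
    split=> //.
    - split=> /=; first by apply: (kerp _ 0) => //; exact: ideal0.
      + move=> a b ha hb; apply: (kerp _ (q a + q b)); first by rewrite pD !qK.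
        exact: idealD.
      + move=> r a ha; apply: (kerp _ (q r * q a)); first by rewrite pM !qK.
        exact: idealMl.
    - by move=> y Iy /=; apply: IL; rewrite /= qK.
  move=> L L' [Li IL _] [Li' IL' _] [LL' nLL']; split=> [y|h]; first exact: LL'.
  apply: nLL' => x /(ker _ _ Li' IL') Lx.
  by apply/(ker _ _ Li IL); exact: h Lx.
apply: (chain_lengths_map (phi := fun L => p @^-1` L)).
  by move=> L [Li IL _]; split=> //; [exact: pi|move=> x /=; exact: IL].
move=> L L' _ _ [LL' nLL']; split=> [x /=|h]; first exact: LL'.
by apply: nLL' => y L'y; have := h (q y); rewrite /= qK; exact.
Qed.

End LengthTransfer.

(** * Noetherian local rings *)

Section Noetherian.
Variable R : comNzRingType.
Implicit Types (I J P Q m : set R) (Ps : seq (set R)).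

Lemma noetherian_acc (F : nat -> set R) : noetherian R ->
    (forall n, is_ideal (F n)) -> (forall n, F n `<=` F n.+1) ->
  exists N, forall n, (N <= n)%N -> F n = F N.
Proof.
move=> noeR Fi FS.
have Fm i j : (i <= j)%N -> F i `<=` F j.
  move=> /subnK <-; elim: (j - i)%N => // k IH; rewrite addSn.
  exact: subset_trans (FS _).
have Ui : is_ideal (\bigcup_n F n).
  split; first by exists 0%N => //; exact: ideal0.
  - move=> a b [i _ Fa] [j _ Fb]; exists (maxn i j) => //; apply: idealD => //.
      exact: Fm (leq_maxl _ _) _ Fa.
    exact: Fm (leq_maxr _ _) _ Fb.
  - by move=> r a [i _ Fa]; exists i => //; exact: idealMl.
have [s Us] := noeR _ Ui.
have [N FN] : exists N, {in s, forall z, F N z}.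
  have : {in s, forall z, (\bigcup_n F n) z}.
    by move=> z zs; rewrite Us; apply: sub_gen_smallest.
  elim: s {Us} => [|z s IH] h; first by exists 0%N.
  have [y ys|N FN] := IH; first by apply: h; rewrite inE ys orbT.
  have [|k _ Fk] := h z; first by rewrite inE eqxx.
  exists (maxn N k) => y; rewrite inE => /orP[/eqP ->|/FN].
    exact: Fm (leq_maxr _ _) _ Fk.
  exact: Fm (leq_maxl _ _) _.
exists N => n Nn; apply/seteqP; split; last exact: Fm.
move=> x Fx; have : (\bigcup_n F n) x by exists n.
rewrite Us; apply: smallest_sub; [exact: Fi|exact: FN].
Qed.

Lemma noetherian_max (C : set R -> Prop) : noetherian R ->
    (exists2 I, is_ideal I & C I) ->
  exists I, [/\ is_ideal I, C I & forall J, is_ideal J -> C J -> I `<=` J -> J = I].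
Proof.
move=> noeR [I0 I0i CI0]; apply: contrapT => nomax.
pose next I := xget I [set J | [/\ is_ideal J, C J & I `<` J]].
have nextP I : is_ideal I -> C I -> [/\ is_ideal (next I), C (next I) & I `<` next I].
  move=> Ii CI; rewrite /next; case: xgetP => [J _ //|no]; exfalso; apply: nomax.
  exists I; split=> // J Ji CJ IJ; apply: contrapT => ne; apply: (no J); split=> //.
  by split=> // JI; apply: ne; apply/seteqP.
pose F n := iter n next I0.
have FP n : is_ideal (F n) /\ C (F n).
  by elim: n => [//|n [Fi CF]]; have [] := nextP _ Fi CF.
have FS n : F n `<` F n.+1 by have [Fi CF] := FP n; have [] := nextP _ Fi CF.
have [||N FN] := noetherian_acc (F := F) noeR.
- by move=> n; case: (FP n).
- by move=> n; case: (FS n).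
by have [_] := FS N; rewrite (FN N.+1)// => /(_ (@subset_refl _ _)).
Qed.

Lemma maximal_unit m x : is_maximal_ideal m -> ~ m x -> exists c, m (1 - c * x).
Proof.
move=> [mi m1 mmax] mx; apply: contrapT => no.
have := mmax _ (adj_ideal x mi) no (@adj_sub _ _ _) => e.
by apply: mx; rewrite -e; exact: adj_mem.
Qed.

Lemma maximal_prime m : is_maximal_ideal m -> is_prime_ideal m.
Proof.
move=> mM; have [mi m1 _] := mM; split=> // a b mab.
have [|ma] := pselect (m a); [by left|right].
have [c mc] := maximal_unit mM ma.
rewrite -(mul1r b) -(subrK (c * a) 1) mulrDl.
by apply: idealD => //; [exact: idealMr|rewrite -mulrA; exact: idealMl].
Qed.

(** Among the proper ideals containing [J], a maximal one exists by Noetherianity; it is a maximal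
    ideal, hence [m]. *)
Lemma proper_sub_maximal m J : noetherian R -> local_ring m ->
  is_ideal J -> ~ J 1 -> J `<=` m.
Proof.
move=> noeR [_ muniq] Ji J1.
have [|M [Mi [JM M1] Mmax]] := @noetherian_max (fun I => J `<=` I /\ ~ I 1) noeR.
  by exists J; [|split].
rewrite -(muniq M)//; split=> // L Li L1 ML; apply: Mmax => //; split=> //.
exact: subset_trans ML.
Qed.

Lemma prime_exp P x n : is_prime_ideal P -> P (x ^+ n) -> P x.
Proof.
move=> [Pi P1 Pp]; elim: n => [|n IH]; first by rewrite expr0.
by rewrite exprS => /Pp[].
Qed.

Lemma prime_of_product P Ps : is_prime_ideal P ->
  foldr (@ideal_mul R) setT Ps `<=` P -> exists2 Q, Q \in Ps & Q `<=` P.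
Proof.
move=> [Pi P1 Pp]; elim: Ps => [|Q Ps IH] /= h; first by exfalso; apply: P1; exact: h.
have [QP|/existsNP[x /not_implyP[Qx Px]]] := pselect (Q `<=` P).
  by exists Q => //; rewrite inE eqxx.
have [|Q' Q's Q'P] := IH; last by exists Q' => //; rewrite inE Q's orbT.
by move=> y Ly; case: (Pp x y (h _ (ideal_mul_mem Qx Ly))).
Qed.

(** Noetherian induction. A maximal counterexample [M] is proper and not prime, so [a * b] is in [M]
    with [a], [b] outside; the lists for [M + (a)] and [M + (b)] are concatenated, as the product of
    these two ideals lies in [M]. *)
Lemma prime_decomposition J : noetherian R -> is_ideal J ->
  exists Ps : seq (set R), {in Ps, forall P, is_prime_ideal P /\ J `<=` P} /\
    foldr (@ideal_mul R) setT Ps `<=` J.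
Proof.
move=> noeR Ji; apply: contrapT => bad.
have [|M [Mi Mbad Mmax]] := @noetherian_max (fun J => ~ exists Ps : seq (set R),
  {in Ps, forall P, is_prime_ideal P /\ J `<=` P} /\
    foldr (@ideal_mul R) setT Ps `<=` J) noeR; first by exists J.
have big L : is_ideal L -> M `<` L -> exists Ps : seq (set R),
    {in Ps, forall P, is_prime_ideal P /\ L `<=` P} /\
    foldr (@ideal_mul R) setT Ps `<=` L.
  move=> Li [ML nLM]; apply: contrapT => Lbad; apply: nLM.
  by rewrite (Mmax L).
have [] : ~ is_prime_ideal M.
  move=> Mp; apply: Mbad; exists [:: M]; split.
    by move=> P; rewrite inE => /eqP ->; split.
  exact: ideal_mul_subl.
split=> //.
  by move=> M1; apply: Mbad; exists [::]; split=> // x _; rewrite (ideal1 Mi M1).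
move=> a b Mab; apply: contrapT => /not_orP[Ma Mb]; apply: Mbad.
have sub z : ~ M z -> M `<` adj z M.
  move=> Mz; split; first exact: adj_sub.
  by move=> h; apply: Mz; apply: h; exact: adj_mem.
have [Ps [Psp Psa]] := big _ (adj_ideal a Mi) (sub _ Ma).
have [Qs [Qsp Qsb]] := big _ (adj_ideal b Mi) (sub _ Mb).
exists (Ps ++ Qs); split.
  move=> P; rewrite mem_cat => /orP[/Psp|/Qsp][Pp aP]; split=> //;
  by apply: subset_trans aP; exact: adj_sub.
have prod_i Ls : is_ideal (foldr (@ideal_mul R) setT Ls).
  by case: Ls => [|? ?]; [exact: idealT|exact: ideal_mul_ideal].
have : foldr (@ideal_mul R) setT (Ps ++ Qs) `<=`
    ideal_mul (foldr (@ideal_mul R) setT Ps) (foldr (@ideal_mul R) setT Qs).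
  elim: Ps {Psp Psa} => [|P Ps IH] /=.
    by move=> x Qx; rewrite -(mul1r x); exact: ideal_mul_mem.
  apply: ideal_mul_min; first exact: ideal_mul_ideal.
  move=> x y Px /IH; move: y.
  apply: (@ideal_mul_min _ _ _ [set y | ideal_mul (ideal_mul P
    (foldr (@ideal_mul R) setT Ps)) (foldr (@ideal_mul R) setT Qs) (x * y)]).
    have Ii := ideal_mul_ideal (ideal_mul P
      (foldr (@ideal_mul R) setT Ps)) (foldr (@ideal_mul R) setT Qs).
    split=> /=; first by rewrite mulr0; exact: (ideal0 Ii).
    - by move=> u v hu hv; rewrite mulrDr; exact: (idealD Ii).
    - by move=> r u hu; rewrite mulrCA; exact: (idealMl _ Ii).
  move=> u v Pu Qv /=; rewrite mulrA; apply: ideal_mul_mem => //.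
  exact: ideal_mul_mem.
move=> PQ x /PQ; move: x; apply: ideal_mul_min => // x y /Psa [c Mc] /Qsb [e Me].
rewrite -(subrK (c * a) x) mulrDl; apply: idealD => //; first exact: idealMr.
rewrite -(subrK (e * b) y) mulrDr; apply: idealD => //; first exact: idealMl.
by rewrite mulrACA; exact: idealMl.
Qed.

Lemma foldr_mul_pow m Ps : {in Ps, forall P, P = m} ->
  foldr (@ideal_mul R) setT Ps = ideal_pow m (size Ps).
Proof.
elim: Ps => //= P Ps IH h; rewrite (h P) ?inE ?eqxx// IH// => Q Qs.
by apply: h; rewrite inE Qs orbT.
Qed.

(** A prime contained in another one of the list is dropped first. Otherwise an element avoiding
    [Ps] that happens to lie in [P] is corrected by some [b] in [m] and in all of [Ps] but not in
    [P]. *)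
Lemma prime_avoidance m Ps : is_ideal m ->
    {in Ps, forall P, is_prime_ideal P /\ ~ (m `<=` P)} ->
  exists2 a, m a & {in Ps, forall P, ~ P a}.
Proof.
move=> mi; have [n] := ubnP (size Ps); elim: n Ps => // n IH [|P Ps] sz h.
  by exists 0; [exact: ideal0|].
have hPs : {in Ps, forall P, is_prime_ideal P /\ ~ (m `<=` P)}.
  by move=> Q Qs; apply: h; rewrite inE Qs orbT.
have [|[Pi P1 Pp] mP] := h P; first by rewrite inE eqxx.
have [[Q [Qs QP]]|noQ] := pselect (exists Q, Q \in Ps /\ Q `<=` P).
  have [||a ma ha] := IH (P :: rem Q Ps).
  - have : (0 < size Ps)%N by case: (Ps) Qs.
    by move: sz; rewrite /= size_rem// ltnS => /leq_trans + Ps0; rewrite prednK//; apply.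
  - move=> L; rewrite inE => /orP[/eqP ->|/mem_rem]; last exact: hPs.
    by apply: h; rewrite inE eqxx.
  exists a => // L; rewrite inE => /orP[/eqP ->|Ls].
    by apply: ha; rewrite inE eqxx.
  move: Ls; rewrite (perm_mem (perm_to_rem Qs)) inE => /orP[/eqP ->|Lr].
    by move=> /QP; apply: ha; rewrite inE eqxx.
  by apply: ha; rewrite inE Lr orbT.
have [|a ma ha] := IH Ps _ hPs; first by rewrite ltnS in sz.
have [Pa|] := pselect (P a); last first.
  by move=> Pa; exists a => // L; rewrite inE => /orP[/eqP ->|/ha].
have [b [mb bPs Pb]] : exists b, [/\ m b, {in Ps, forall Q : set R, Q b} & ~ P b].
  elim: Ps hPs noQ {h ha sz} => [|Q Ps IHb] hPs noQ.
    by have /existsNP[x /not_implyP[mx Px]] := mP; exists x.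
  have [||b [mb bPs Pb]] := IHb.
  - by move=> L Ls; apply: hPs; rewrite inE Ls orbT.
  - by move=> [L [Ls LP]]; apply: noQ; exists L; split=> //; rewrite inE Ls orbT.
  have /existsNP[x /not_implyP[Qx Px]] : ~ (Q `<=` P).
    by move=> QP; apply: noQ; exists Q; rewrite inE eqxx.
  exists (b * x); split; first exact: idealMr.
    move=> L; rewrite inE => /orP[/eqP ->|Ls].
      by have [|[Qi _ _] _] := hPs Q; [rewrite inE eqxx|exact: idealMl].
    have [|[Li _ _] _] := hPs L; first by rewrite inE Ls orbT.
    by apply: idealMr => //; exact: bPs.
  by move=> /Pp[].
exists (a + b); first exact: idealD.
move=> L; rewrite inE => /orP[/eqP -> Pab|Ls Lab].
  by apply: Pb; rewrite -(addKr a b) addrC; apply: idealB.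
have [[Li _ _] _] := hPs _ Ls.
by apply: (ha _ Ls); rewrite -(addrK b a); apply: idealB => //; exact: bPs.
Qed.

Lemma m_primary_sub m I : m_primary m I -> I `<=` m.
Proof. by move=> [Ii <-] x Ix; exists 1%N; rewrite expr1. Qed.

Lemma m_primary_proper m I : is_maximal_ideal m -> m_primary m I -> ~ I 1.
Proof. by move=> [_ m1 _] /m_primary_sub Im /Im. Qed.

(** Every prime of the decomposition contains [I], hence its radical [m], hence equals [m]; their
    product is a power of [m]. *)
Lemma m_primary_pow m I : noetherian R -> local_ring m -> m_primary m I ->
  exists r, ideal_pow m r `<=` I.
Proof.
move=> noeR locR [Ii radI]; have [[mi m1 mmax] _] := locR.
have [Ps [Psp PsI]] := prime_decomposition noeR Ii.
exists (size Ps); rewrite -foldr_mul_pow// => P /Psp [Pp IP].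
have [Pi P1 _] := Pp; have Pm := proper_sub_maximal noeR locR Pi P1.
apply/seteqP; split=> // x; rewrite -radI => -[n In].
by apply: prime_exp Pp (IP _ In).
Qed.

Lemma m_primary_of_pow m I r : noetherian R -> local_ring m ->
  is_ideal I -> ~ I 1 -> ideal_pow m r `<=` I -> m_primary m I.
Proof.
move=> noeR locR Ii I1 mI; split=> //; apply/seteqP; split=> x.
  move=> [n /(proper_sub_maximal noeR locR Ii I1)].
  by apply: prime_exp; case: locR => /maximal_prime.
by move=> mx; exists r; apply: mI; exact: ideal_pow_mem.
Qed.

End Noetherian.

(** * Monomials and leading coefficients *)

Section Monomials.
Implicit Types (al be ga : seq nat).

(** Exponent vectors of [s] variables in degree [k]. The order of enumeration matters: it is
    lexicographically increasing, so a suffix of the list holds exactly the vectors larger than the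
    one before it. *)
Fixpoint monos (s k : nat) : seq (seq nat) :=
  if s is s'.+1 then
    flatten [seq [seq j :: be | be <- monos s' (k - j)] | j <- iota 0 k.+1]
  else if k is 0 then [:: [::]] else [::].

Lemma mem_monos s k al : (al \in monos s k) = (size al == s) && (sumn al == k).
Proof.
elim: s k al => [|s IH] k al.
  by case: k => [|k]; case: al => [|a al].
apply/flatten_mapP/idP => [[j + /mapP[be + ->]]|].
  rewrite mem_iota add0n ltnS IH => /= jk /andP[/eqP -> /eqP ->].
  by rewrite eqxx subnKC ?eqxx.
case: al => // j al; rewrite [size _]/= [sumn _]/= eqSS => /andP[/eqP sal /eqP sumal].
exists j; first by rewrite mem_iota add0n ltnS -sumal leq_addr.
by apply/mapP; exists al => //; rewrite IH sal -sumal addKn !eqxx.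
Qed.

Fixpoint lexlt al be : bool :=
  match al, be with
  | a :: al', b :: be' => (a < b)%N || ((a == b) && lexlt al' be')
  | _, _ => false
  end.

Lemma lexlt_irr al : lexlt al al = false.
Proof. by elim: al => //= a al ->; rewrite ltnn eqxx. Qed.

Lemma lexlt_asym al be : lexlt al be -> lexlt be al = false.
Proof.
elim: al be => [|a al IH] [|b be] //= /orP[ab|/andP[/eqP -> /IH ->]].
  by rewrite ltnNge (ltnW ab)/= (gtn_eqF ab).
by rewrite ltnn eqxx.
Qed.

Lemma monos_pairwise s k : pairwise lexlt (monos s k).
Proof.
elim: s k => [|s IH] k; first by case: k.
suff aux n i : pairwise lexlt
    (flatten [seq [seq j :: be | be <- monos s (k - j)] | j <- iota i n]).
  exact: (aux k.+1 0%N).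
elim: n i => //= n IHn i.
rewrite pairwise_cat IHn andbT; apply/andP; split.
  apply/allrelP => x y /mapP[be _ ->] /flatten_mapP[j + /mapP[ga _ ->]].
  by rewrite mem_iota => /andP[ij _] /=; rewrite ij.
rewrite pairwise_map; apply: sub_pairwise (IH (k - i)%N) => x y /=.
by rewrite ltnn eqxx.
Qed.

Lemma mem_monos_suffix s k p al q : monos s k = p ++ al :: q ->
  q =i [seq be <- monos s k | lexlt al be].
Proof.
move=> e be; rewrite mem_filter; have := monos_pairwise s k; rewrite e.
rewrite pairwise_cat /= => /and3P[/allrelP pq _ /andP[/allP alq _]].
apply/idP/andP => [bq|[albe]]; first by rewrite alq// mem_cat inE bq !orbT.
rewrite mem_cat inE => /orP[bp|/orP[/eqP e'|//]].
  by have := pq _ _ bp (mem_head _ _); rewrite (lexlt_asym albe).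
by move: albe; rewrite e' lexlt_irr.
Qed.

Lemma size_monosS s k :
  size (monos s.+1 k) = (\sum_(j < k.+1) size (monos s (k - j)))%N.
Proof.
rewrite -(big_mkord xpredT (fun j => size (monos s (k - j)))) /index_iota subn0.
rewrite size_flatten /shape -map_comp sumnE big_map.
by apply: eq_bigr => j _; rewrite /= size_map.
Qed.

Lemma size_monos_le s k : (size (monos s.+1 k) <= k.+1 ^ s)%N.
Proof.
elim: s k => [|s IH] k; rewrite size_monosS.
  rewrite big_ord_recr subnn /= big1// => j _.
  by rewrite -(subnSK (ltn_ord j)).
apply: (@leq_trans (\sum_(j < k.+1) k.+1 ^ s)%N); last first.
  by rewrite sum_nat_const card_ord expnS.
apply: leq_sum => j _; apply: leq_trans (IH _) _.
by case: (s) => // t; rewrite leq_exp2r// ltnS leq_subr.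
Qed.

End Monomials.

(** * Ideals of leading coefficients with respect to monomials in generators *)

Section MonomialAlgebra.
Variable R : comNzRingType.
Implicit Types (al be ga : seq nat) (z : seq R) (N I G : set R).

Fixpoint mon z al : R :=
  if z is x :: z' then
    if al is a :: al' then x ^+ a * mon z' al' else 1
  else 1.

Definition addm al be : seq nat := [seq p.1 + p.2 | p <- zip al be]%N.

Lemma size_addm al be : size al = size be -> size (addm al be) = size be.
Proof. by move=> e; rewrite size_map size2_zip ?e. Qed.

Lemma addm_cons a al b be : addm (a :: al) (b :: be) = (a + b)%N :: addm al be.
Proof. by []. Qed.

Lemma sumn_addm al be : size al = size be ->
  sumn (addm al be) = (sumn al + sumn be)%N.
Proof.
elim: al be => [|a al IH] [|b be] //= [e].
by rewrite IH// addnACA.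
Qed.

Lemma lexlt_addm al be ga : size al = size be -> size al = size ga ->
  lexlt (addm al ga) (addm be ga) = lexlt al be.
Proof.
elim: al be ga => [|a al IH] [|b be] [|c ga] //= [e1] [e2].
by rewrite ltn_add2r eqn_add2r; congr (_ || (_ && _)); exact: IH.
Qed.

Lemma mon_addm z al be : size al = size be ->
  mon z (addm al be) = mon z al * mon z be.
Proof.
elim: z al be => [|x z IH] [|a al] [|b be] //=; rewrite ?mulr1// => -[e].
by rewrite (IH al be e) exprD mulrACA.
Qed.

Lemma mon_nseq0 z n : mon z (nseq n 0%N) = 1.
Proof. by elim: z n => [|x z IH] [|n] //=; rewrite IH expr0 mulr1. Qed.

Lemma mon_pow z al I : is_ideal I -> {in z, forall x, I x} -> size al = size z ->
  ideal_pow I (sumn al) (mon z al).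
Proof.
move=> Ii; elim: z al => [|x z IH] [|a al] //= zI [e].
apply: ideal_powD; first by apply: ideal_pow_mem; apply: zI; rewrite inE eqxx.
by apply: IH => // y yz; apply: zI; rewrite inE yz orbT.
Qed.

Lemma mon_mul z x al : x \in z -> size al = size z ->
  exists be, [/\ size be = size z, sumn be = (sumn al).+1 & mon z be = x * mon z al].
Proof.
elim: z al => // y z IH [|a al] // + [e]; rewrite inE => /orP[/eqP ->|xz].
  by exists (a.+1 :: al); split=> //=; rewrite ?e// exprS mulrA.
have [be [sb sumb mb]] := IH _ xz e.
by exists (a :: be); split; rewrite /= ?sb ?sumb ?addnS// mb mulrCA.
Qed.

Lemma ideal_pow_monos z k : let I := span [set 0] z in
  ideal_pow I k = span [set 0] [seq mon z al | al <- monos (size z) k].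
Proof.
move=> I; have Ii : is_ideal I by apply: span_ideal; exact: ideal_set0.
have Si j : is_ideal (span [set 0] [seq mon z al | al <- monos (size z) j]).
  by apply: span_ideal; exact: ideal_set0.
apply/seteqP; split.
  elim: k => [|k IH].
    rewrite (_ : span _ _ = setT)//; apply: ideal1 => //.
    apply: span_mem; first exact: ideal_set0.
    apply/mapP; exists (nseq (size z) 0%N); last by rewrite mon_nseq0.
    by rewrite mem_monos size_nseq sumn_nseq mul0n !eqxx.
  rewrite ideal_powS; apply: ideal_mul_min => // a b Ia /IH sb.
  have h x : x \in z -> span [set 0] [seq mon z al | al <- monos (size z) k] `<=`
      colon (span [set 0] [seq mon z al | al <- monos (size z) k.+1]) x.
    move=> xz; apply: span_min; first exact: colon_ideal.
      move=> _ /mapP[al + ->]; rewrite mem_monos => /andP[/eqP sa /eqP suma].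
      have [be [sbe sumb mb]] := mon_mul xz sa.
      rewrite /colon /= mulrC -mb; apply: span_mem; first exact: ideal_set0.
      by apply/mapP; exists be => //; rewrite mem_monos sbe sumb suma !eqxx.
    by move=> _ ->; exact: ideal0 (colon_ideal _ _).
  have : I `<=` colon (span [set 0] [seq mon z al | al <- monos (size z) k.+1]) b.
    apply: span_min; first exact: colon_ideal.
      by move=> x xz; rewrite /colon /= mulrC; exact: h.
    by move=> _ ->; exact: ideal0 (colon_ideal _ _).
  exact.
apply: span_min; first exact: ideal_pow_ideal.
  move=> _ /mapP[al + ->]; rewrite mem_monos => /andP[/eqP sa /eqP <-].
  by apply: mon_pow => // x xz; apply: span_mem => //; exact: ideal_set0.
by move=> _ ->; exact: ideal0 (ideal_pow_ideal _ _).
Qed.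

Lemma spanE G s x : is_ideal G ->
  span G s x <-> exists2 y, span [set 0] s y & G (x + y).
Proof.
move=> Gi; elim: s x => [|z s IH] x /=.
  by split=> [Gx|[y -> ]]; [exists 0 => //|]; rewrite addr0.
split=> [[c /IH[y sy Gy]]|[y [c sc] Gy]].
  by exists (y - c * z); [exists (- c); rewrite mulNr opprK subrK|rewrite addrCA addrC].
by exists (- c); apply/IH; exists (y - c * z) => //; rewrite mulNr opprK addrACA addrN addr0.
Qed.

Definition tails z al : seq R :=
  [seq mon z be | be <- monos (size al) (sumn al) & lexlt al be].

(* Coefficients at [al] of the forms of degree [sumn al] whose value at [z] is
   in [N] and whose other monomials are lexicographically larger. *)
Definition lead z N al : set R :=
  [set c | exists2 y, span [set 0] (tails z al) y & N (c * mon z al + y)].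

Lemma lead_ideal z N al : is_ideal N -> is_ideal (lead z N al).
Proof.
move=> Ni; have Si := span_ideal (tails z al) (ideal_set0 R).
split.
- by exists 0; [exact: ideal0|rewrite mul0r add0r; exact: ideal0].
- move=> a b [x sx Nx] [y sy Ny]; exists (x + y); first exact: idealD.
  by rewrite mulrDl addrACA; exact: idealD.
- move=> r a [x sx Nx]; exists (r * x); first exact: idealMl.
  by rewrite -mulrA -mulrDr; exact: idealMl.
Qed.

Lemma tails_addm z al ga y : size al = size ga ->
  span [set 0] (tails z al) y -> span [set 0] (tails z (addm al ga)) (y * mon z ga).
Proof.
move=> e; have Si := span_ideal (tails z (addm al ga)) (ideal_set0 R).
apply: (@span_min _ _ _ (colon (span [set 0] (tails z (addm al ga))) (mon z ga))).
- exact: colon_ideal.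
- move=> _ /mapP[be + ->]; rewrite mem_filter mem_monos => /and3P[lab /eqP sb /eqP sumb].
  rewrite /colon /= -mon_addm ?sb//; apply: span_mem; first exact: ideal_set0.
  apply/mapP; exists (addm be ga) => //.
  by rewrite mem_filter mem_monos lexlt_addm ?sb// lab !size_addm ?sb// !sumn_addm ?sb// sumb !eqxx.
- by move=> _ ->; exact: ideal0 (colon_ideal _ _).
Qed.

(** Multiplying a form by [mon z ga] shifts all its exponents alike and preserves their
    lexicographic order, so the leading coefficient survives. This supplies the monotonicity
    demanded by [ladder]. *)
Lemma lead_mono z N N' al ga : size al = size ga ->
    (forall x, N x -> N' (x * mon z ga)) ->
  lead z N al `<=` lead z N' (addm al ga).
Proof.
move=> e NN' c [y sy Ny]; exists (y * mon z ga); first exact: tails_addm.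
by rewrite mon_addm// mulrA -mulrDl; exact: NN'.
Qed.

Lemma span_tails z s k p al q y : monos s k = p ++ al :: q ->
  span [set 0] [seq mon z be | be <- q] y <-> span [set 0] (tails z al) y.
Proof.
move=> e; have : al \in monos s k by rewrite e mem_cat inE eqxx orbT.
rewrite mem_monos => /andP[/eqP sal /eqP sumal].
have qe := mem_monos_suffix e; rewrite /tails sal sumal.
split; apply: span_mono => //; [exact: ideal_set0| |exact: ideal_set0|];
by move=> _ /mapP[be bq ->]; apply: map_f; rewrite ?qe// -?qe.
Qed.

(** Monomials are adjoined to [N] from the lexicographically largest downwards; together with
    [len_adj] this makes the quotient at the step [al] have the length of [R / lead z N al]. *)
Lemma lead_colon z N s k p al q : is_ideal N -> monos s k = p ++ al :: q ->
  colon (span N [seq mon z be | be <- q]) (mon z al) = lead z N al.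
Proof.
move=> Ni e; apply/seteqP; split=> [c /spanE[//|y sy Ny]|c [y sy Ny]].
  by exists y => //; exact/(span_tails _ _ e).
by apply/spanE => //; exists y => //; exact/(span_tails _ _ e).
Qed.

End MonomialAlgebra.

(** * Stabilization of monotone ideal-valued functions of exponents *)

Section Stabilization.
Variable R : comNzRingType.

Lemma bounded_on_box s c (N : seq nat -> nat) :
  exists B, forall al, size al = s -> all (fun a => a <= c)%N al -> (N al <= B)%N.
Proof.
elim: s N => [|s IH] N; first by exists (N [::]) => -[].
have [B BP] := choice (fun j => IH (fun al => N (j :: al))).
exists (\max_(j < c.+1) B j) => -[//|a al] [sal] /= /andP[ac alc].
apply: leq_trans (BP a al sal alc) _.
exact: (@leq_bigmax _ (fun j : 'I_c.+1 => B j) (Ordinal (ac : (a < c.+1)%N))).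
Qed.

(** Monotonicity for the product order, written additively because the inclusions come from
    multiplication by monomials. *)
Definition ladder s (L : seq nat -> set R) :=
  (forall al, is_ideal (L al)) /\
  forall al ga, size al = s -> size ga = s -> L al `<=` L (addm al ga).

Lemma addm_minn c al : addm [seq minn c a | a <- al] [seq (a - c)%N | a <- al] = al.
Proof.
elim: al => //= a al IH; rewrite addm_cons IH; congr (_ :: _).
by lia.
Qed.

Lemma ladder_minn s L c al : ladder s L -> size al = s ->
  L [seq minn c a | a <- al] `<=` L al.
Proof.
move=> [_ mono] sal; have := mono [seq minn c a | a <- al] [seq (a - c)%N | a <- al].
by rewrite addm_minn; apply; rewrite size_map.
Qed.

Lemma map_minn_minn c c' al : (c <= c')%N ->
  [seq minn c a | a <- [seq minn c' a | a <- al]] = [seq minn c a | a <- al].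
Proof.
by move=> cc; rewrite -map_comp; apply: eq_map => a /=; rewrite minnA (minn_idPl cc).
Qed.

Lemma ladder_stable_le s L c c' : ladder s L -> (c <= c')%N ->
    (forall al, size al = s -> L al = L [seq minn c a | a <- al]) ->
  forall al, size al = s -> L al = L [seq minn c' a | a <- al].
Proof.
move=> lad cc st al sal; apply/seteqP; split; last exact: ladder_minn lad sal.
rewrite (st _ sal) -(map_minn_minn al cc); apply: (ladder_minn (s := s)) => //.
by rewrite size_map.
Qed.

(* Dickson's lemma for ideal-valued functions on exponent vectors. *)
Lemma ladder_stable s (L : seq nat -> set R) : noetherian R -> ladder s L ->
  exists c, forall al, size al = s -> L al = L [seq minn c a | a <- al].
Proof.
move=> noeR; elim: s L => [|s IH] L lad; first by exists 0%N => -[].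
have [Li mono] := lad.
have slice j : ladder s (fun be => L (j :: be)).
  split=> // al ga sal sga; have := mono (j :: al) (0%N :: ga).
  by rewrite addm_cons addn0; apply; rewrite /= ?sal ?sga.
have up i j be : (i <= j)%N -> size be = s -> L (i :: be) `<=` L (j :: be).
  move=> ij sbe; have := mono (i :: be) ((j - i)%N :: nseq s 0%N).
  rewrite addm_cons subnKC// (_ : addm be _ = be).
    by apply; rewrite /= ?sbe ?size_nseq.
  by rewrite -sbe; elim: be {sbe} => //= b be IHb; rewrite addm_cons addn0 IHb.
have /choice[N NP] be : exists N, size be = s ->
    forall n, (N <= n)%N -> L (n :: be) = L (N :: be).
  have [sbe|] := pselect (size be = s); last by exists 0%N.
  have [|n|N NP] := noetherian_acc (F := fun n => L (n :: be)) noeR; [by []|exact: up|].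
  by exists N.
have Ninf be n m : size be = s -> (N be <= n)%N -> (N be <= m)%N ->
    L (n :: be) = L (m :: be).
  by move=> sbe nN mN; rewrite (NP _ sbe n)// (NP _ sbe m).
(* The stable value in the direction of the first exponent is again a ladder, in one variable
   fewer. *)
pose Linf be := L (N be :: be).
have ladinf : ladder s Linf.
  split=> [al|al ga sal sga]; [exact: Li|rewrite /Linf].
  have sadd : size (addm al ga) = s by rewrite size_addm ?sal ?sga.
  rewrite (@Ninf al (N al) (maxn (N al) (N (addm al ga))) sal)// ?leq_maxl//.
  rewrite (@Ninf (addm al ga) (N (addm al ga)) (maxn (N al) (N (addm al ga))) sadd)// ?leq_maxr//.
  exact: (slice _).2.
have [c cP] := IH _ ladinf.
(* The thresholds [N be] have no uniform bound a priori, but only vectors capped at [c] matter for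
   [Linf], and these are finite in number. *)
have [j0 j0P] := bounded_on_box s c N.
have sm b (be : seq nat) : size be = s -> size [seq minn b a | a <- be] = s.
  by rewrite size_map.
have topE j be : (j0 <= j)%N -> size be = s -> L (j :: be) = Linf be.
  move=> jj sbe; apply/seteqP; split.
    rewrite /Linf (@Ninf be (N be) (maxn j (N be)) sbe)// ?leq_maxr//.
    by apply: up => //; rewrite leq_maxl.
  rewrite (cP _ sbe) /Linf (@Ninf _ (N _) j (sm c _ sbe))//; last first.
    apply: leq_trans jj; apply: j0P; first exact: sm.
    by apply/allP => _ /mapP[a _ ->]; rewrite geq_minl.
  exact: (ladder_minn (c := c) (slice j) sbe).
have [C CP] := choice (fun j => IH _ (slice j)).
(* Beyond [j0] all slices equal [Linf], stable from [c]; the finitely many slices below [j0]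
   contribute their own bounds. *)
pose c' := maxn (maxn c j0) (\max_(j < j0) C j).
exists c' => -[//|j be] [sbe] /=.
have [jlt|jge] := ltnP j j0.
  rewrite (minn_idPr _); last first.
    by rewrite /c' !leq_max (ltnW jlt) orbT.
  apply: (ladder_stable_le (slice j) _ (CP j)) => //.
  apply: leq_trans (leq_maxr _ _).
  exact: (@leq_bigmax _ (fun j : 'I_j0 => C j) (Ordinal jlt)).
rewrite !topE ?sm//; last by rewrite leq_min jge /c' !leq_max leqnn orbT.
apply: (ladder_stable_le ladinf _ cP) => //.
by rewrite /c' !leq_max leqnn.
Qed.

End Stabilization.

(** * Eventually polynomial sequences *)

Section EventuallyPolynomial.
Variable V : zmodType.
Implicit Types u v : nat -> V.

Definition dlt u : nat -> V := fun n => u n.+1 - u n.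

(* Being eventually polynomial is having an eventually zero iterated difference. *)
Definition evp u := exists q N, forall n, (N <= n)%N -> iter q dlt u n = 0.

Lemma iter_dlt_eq u v q N j : (forall n, (N <= n)%N -> u n = v (n + j)%N) ->
  forall n, (N <= n)%N -> iter q dlt u n = iter q dlt v (n + j)%N.
Proof.
move=> uv; elim: q => //= q IH n Nn.
by rewrite /dlt !IH ?addSn// (leq_trans Nn).
Qed.

Lemma evp_eq u v N : (forall n, (N <= n)%N -> u n = v n) -> evp v -> evp u.
Proof.
move=> uv [q [M vP]]; exists q, (maxn N M) => n; rewrite geq_max => /andP[Nn Mn].
by rewrite (@iter_dlt_eq u v q N 0)// ?addn0 ?vP// => k Nk; rewrite addn0 uv.
Qed.

Lemma evp_succ u : evp u -> evp (fun n => u n.+1).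
Proof.
move=> [q [N uP]]; exists q, N => n Nn.
rewrite (@iter_dlt_eq _ u q 0 1)//; first by rewrite addn1 uP// (leq_trans Nn).
by move=> k _; rewrite addn1.
Qed.

Lemma evp_shift u j : evp u -> evp (fun n => u (n - j)%N).
Proof.
move=> [q [N uP]]; exists q, (N + j)%N => n Nn.
have jn : (j <= n)%N by lia.
have := @iter_dlt_eq u (fun n => u (n - j)%N) q 0 j _ (n - j)%N isT.
rewrite subnK// => <-; first by rewrite uP//; lia.
by move=> k _; rewrite addnK.
Qed.

Lemma iter_dltD u v q n :
  iter q dlt (fun n => u n + v n) n = iter q dlt u n + iter q dlt v n.
Proof.
by elim: q n => //= q IH n; rewrite /dlt !IH opprD addrACA.
Qed.

Lemma iter_dlt_raise u q q' N : (q <= q')%N ->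
    (forall n, (N <= n)%N -> iter q dlt u n = 0) ->
  forall n, (N <= n)%N -> iter q' dlt u n = 0.
Proof.
move=> /subnK <-; elim: (q' - q)%N => // k IH uP n Nn.
by rewrite addSn /= /dlt !IH ?subr0// (leq_trans Nn).
Qed.

Lemma evp0 : evp (fun=> 0).
Proof. by exists 0%N, 0%N. Qed.

Lemma evpD u v : evp u -> evp v -> evp (fun n => u n + v n).
Proof.
move=> [q [N uP]] [q' [N' vP]]; exists (maxn q q'), (maxn N N') => n.
rewrite geq_max => /andP[Nn Nn'].
by rewrite iter_dltD (iter_dlt_raise (leq_maxl _ _) uP)// (iter_dlt_raise (leq_maxr _ _) vP)// addr0.
Qed.

Lemma evp_sum_ord (m : nat) (u : nat -> nat -> V) : (forall j, evp (u j)) ->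
  evp (fun n => \sum_(j < m) u j n).
Proof.
move=> uP; elim: m => [|m IH].
  by apply: (evp_eq (N := 0) _ evp0) => n _; rewrite big_ord0.
apply: (evp_eq (N := 0) _ (evpD IH (uP m))) => n _.
by rewrite big_ord_recr.
Qed.

Lemma evp_cumsum u : evp u -> evp (fun n => \sum_(i < n) u i).
Proof.
move=> [q [N uP]]; exists q.+1, N => n Nn; rewrite iterSr.
rewrite (@iter_dlt_eq _ u q 0 0)// ?addn0 ?uP// => k _.
by rewrite addn0 /dlt big_ord_recr /= [X in X - _]addrC addrK.
Qed.

(** The coefficient [c i] is the [i]-th iterated difference of [u] at [N]; the induction is Pascal's
    rule. *)
Lemma newton_forward_difference u q N : (forall n, (N <= n)%N -> iter q dlt u n = 0) ->
  exists c : nat -> V, forall m, u (N + m)%N = \sum_(i < q) c i *+ 'C(m, i).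
Proof.
elim: q u => [|q IH] u uP.
  by exists (fun=> 0) => m; rewrite big_ord0; apply: (uP (N + m)%N); rewrite leq_addr.
have [|c cP] := IH (dlt u); first by move=> n /uP; rewrite iterSr.
exists (fun i => if i is i'.+1 then c i' else u N) => m.
rewrite big_ord_recl /= bin0 mulr1n; elim: m => [|m IHm].
  by rewrite addn0 big1 ?addr0// => i _; rewrite bin0n.
rewrite addnS -(subrK (u (N + m)%N) (u (N + m).+1)) -/(dlt u (N + m)%N) cP IHm.
rewrite addrC -addrA; congr (_ + _); rewrite -big_split /=.
by apply: eq_bigr => i _; rewrite /bump add1n binS mulrnDr addrC.
Qed.

(** Splitting by the first exponent [j] leaves finitely many shifted sums for [j < c], while all
    those with [j >= c] come from the same function [H c] and form a cumulative sum. Without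
    variables the sum vanishes in positive degrees. *)
Lemma evp_monos s c (f : seq nat -> V) :
    (forall al, size al = s -> f al = f [seq minn c a | a <- al]) ->
  evp (fun k => \sum_(al <- monos s k) f al).
Proof.
elim: s f => [|s IH] f fP.
  by apply: (evp_eq (N := 1) _ evp0) => -[//|n] _; rewrite big_nil.
pose H j k := \sum_(al <- monos s k) f (j :: al).
have Hev j : evp (H j).
  apply: (IH (fun al => f (j :: al))) => al sal.
  rewrite (fP (j :: al)) /= ?sal// (fP (j :: [seq minn c a | a <- al])) /= ?size_map ?sal//.
  by rewrite map_minn_minn.
have Hc j k : (c <= j)%N -> H j k = H c k.
  move=> cj; rewrite /H !big_seq; apply: eq_bigr => al.
  rewrite mem_monos => /andP[/eqP sal _].
  by rewrite (fP (j :: al)) /= ?sal// (fP (c :: al)) /= ?sal// minnn (minn_idPl cj).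
have e k : \sum_(al <- monos s.+1 k) f al = \sum_(j < k.+1) H j (k - j)%N.
  rewrite -(big_mkord xpredT (fun j => H j (k - j)%N)) /index_iota subn0.
  by rewrite big_flatten big_map; apply: eq_bigr => j _; rewrite big_map.
apply: (@evp_eq _ (fun k => \sum_(j < c) H j (k - j)%N +
    \sum_(i < (k - c).+1) H c i) c).
  move=> k ck; rewrite e -(big_mkord xpredT (fun j => H j (k - j)%N)).
  rewrite (@big_cat_nat _ _ _ c)//=; last by lia.
  rewrite big_mkord; congr (_ + _).
  rewrite -(big_mkord xpredT (H c)) -{1}(add0n c) big_addn subSn// big_nat_rev /=.
  rewrite !big_nat; apply: eq_bigr => i /andP[_ ik].
  by rewrite Hc ?leq_addl//; congr (H c _); lia.
apply: evpD; first by apply: (evp_sum_ord c (u := fun j k => H j (k - j)%N)) => j; exact: (evp_shift j (Hev j)).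
exact: (evp_shift c (evp_succ (evp_cumsum (Hev c)))).
Qed.

End EventuallyPolynomial.

(** * Hilbert-Samuel functions and chains of primes *)

Section HilbertSamuel.
Variable R : comNzRingType.
Implicit Types (z : seq R) (I N P m : set R).

(** The monomials of [q] are adjoined to [N] one by one; [lead_colon] gives each cyclic quotient and
    [len_additive] adds them up. *)
Lemma len_monos_suffix z N s k p q : is_ideal N -> monos s k = p ++ q ->
    (forall al, al \in q -> flen setT (lead z N al)) ->
  flen (span N [seq mon z al | al <- q]) N /\
  len (span N [seq mon z al | al <- q]) N = (\sum_(al <- q) len setT (lead z N al))%N.
Proof.
move=> Ni; elim: q p => [|al q IH] p e fl.
  rewrite big_nil /= len_refl//; split=> //.
  exists 0%N => -[//|n] [c [cF cS]].
  have [_ h] := cS 0%N isT; have [_ Nc _] := cF 0%N isT; have [_ _ cN] := cF 1%N isT.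
  by exfalso; apply: h; exact: subset_trans Nc.
have [||fl' le'] := IH (rcons p al); first by rewrite cat_rcons.
  by move=> be bq; apply: fl; rewrite inE bq orbT.
have Si := span_ideal [seq mon z al | al <- q] Ni.
have := len_adj (mon z al) Si; rewrite (lead_colon _ Ni e) => -[flE lenE].
rewrite big_cons -le' -lenE /=.
apply: len_additive => //; [exact: adj_ideal|exact: span_sub|exact: adj_sub|].
by apply/flE; apply: fl; rewrite inE eqxx.
Qed.

Lemma flen_pow z (I := span [set 0] z) : flen setT I -> forall n,
  flen setT (ideal_pow I n) /\ len setT (ideal_pow I n) =
    (\sum_(k < n) \sum_(al <- monos (size z) k)
       len setT (lead z (ideal_pow I (sumn al).+1) al))%N.
Proof.
move=> fl n; have Ii : is_ideal I := span_ideal z (ideal_set0 R).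
have Pi := @ideal_pow_ideal R I.
elim: n => [|n [fln IH]].
  rewrite big_ord0; split; last by rewrite len_refl.
  by apply: flen_sub fl.
have flL al : al \in monos (size z) n -> flen setT (lead z (ideal_pow I n.+1) al).
  rewrite mem_monos => /andP[/eqP sal /eqP <-].
  apply: flen_sub fl => // x Ix; exists 0; first exact: ideal0 (span_ideal _ (ideal_set0 R)).
  rewrite addr0; apply: ideal_mul_mem => //; apply: mon_pow => // y yz.
  exact: span_mem (ideal_set0 R) yz.
have [] := @len_monos_suffix z _ _ _ [::] _ (Pi n.+1) (erefl (monos (size z) n)) flL.
have -> : span (ideal_pow I n.+1) [seq mon z al | al <- monos (size z) n] = ideal_pow I n.
  apply/seteqP; split.
    apply: span_min => //; last exact: ideal_pow_sub.
    by move=> x xs; rewrite ideal_pow_monos; exact: span_mem (ideal_set0 R) xs.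
  rewrite {1}ideal_pow_monos; apply: span_mono => //.
  by move=> _ ->; exact: ideal0.
move=> flS lenS; have [] := @len_additive R (ideal_pow I n.+1) (ideal_pow I n) setT => //.
  exact: ideal_pow_sub.
move=> ? ->; split=> //; rewrite big_ord_recr /= -IH lenS; congr addn.
rewrite !big_seq; apply: eq_bigr => al; rewrite mem_monos => /andP[_ /eqP suma].
by rewrite suma.
Qed.

Lemma evp_len_pow (K : pzRingType) z (I := span [set 0] z) :
  noetherian R -> flen setT I ->
  evp (fun n => (len setT (ideal_pow I n))%:R : K).
Proof.
move=> noeR fl; have Ii : is_ideal I := span_ideal z (ideal_set0 R).
have zI : {in z, forall x, I x} by move=> x; exact: span_mem (ideal_set0 R).
(* The base ideal moves with the degree: [mon z ga] sends the power [sumn al + 1] of [I] into the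
   power [sumn al + sumn ga + 1], so [L] is still a ladder. *)
pose L al := lead z (ideal_pow I (sumn al).+1) al.
have [|c cP] := @ladder_stable R (size z) L noeR.
  split=> [al|al ga sal sga]; first exact: lead_ideal (ideal_pow_ideal _ _).
  apply: lead_mono; first by rewrite sga.
  move=> x; rewrite sumn_addm ?sal ?sga// -addSn => Ix.
  by apply: ideal_powD => //; exact: mon_pow.
apply: (@evp_eq _ _ (fun n => \sum_(k < n) \sum_(al <- monos (size z) k)
    (len setT (L al))%:R) 0%N).
  move=> n _; rewrite (flen_pow fl n).2 natr_sum; apply: eq_bigr => k _.
  by rewrite natr_sum.
apply: (@evp_cumsum _ (fun k => \sum_(al <- monos (size z) k) (len setT (L al))%:R)).
by apply: (@evp_monos _ _ c) => al sal; rewrite -cP.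
Qed.

(** Every leading ideal contains [I], so each monomial of degree [k] contributes at most the
    colength of [I]; the number of these monomials has degree [s] in [k]. *)
Lemma len_pow_le z s (I := span [set 0] z) : size z = s.+1 -> flen setT I ->
  forall n, (len setT (ideal_pow I n) <= len setT I * n ^ s.+1)%N.
Proof.
move=> sz fl n; have Ii : is_ideal I := span_ideal z (ideal_set0 R).
rewrite (flen_pow fl n).2; apply: (@leq_trans (\sum_(k < n) n ^ s * len setT I)%N).
  apply: leq_sum => k _.
  apply: (@leq_trans (\sum_(al <- monos (size z) k) len setT I)%N).
    rewrite big_seq [leqRHS]big_seq; apply: leq_sum => al.
    rewrite mem_monos => /andP[/eqP sal _].
    apply: len_antitone => //; [exact: lead_ideal (ideal_pow_ideal _ _)|].
    move=> x Ix; exists 0; first exact: ideal0 (span_ideal _ (ideal_set0 R)).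
    rewrite addr0; apply: ideal_mul_mem => //; apply: mon_pow => // y yz.
    exact: span_mem (ideal_set0 R) yz.
  rewrite big_const_seq iter_addn_0 count_predT mulnC leq_mul2r; apply/orP; right.
  rewrite sz; apply: leq_trans (size_monos_le _ _) _.
  by case: (s) => // t; rewrite leq_exp2r.
by rewrite sum_nat_const card_ord mulnA -expnS mulnC.
Qed.

(** A reduction of Groebner type. The leading coefficient of [x] already occurs at the exponent
    capped at [c], in an element of [N]; subtracting its multiple by the remaining monomial leaves
    only lexicographically larger terms. *)
Lemma artin_rees z N (I := span [set 0] z) : noetherian R -> is_ideal N ->
  exists c, forall k x, N x -> ideal_pow I k x -> ideal_mul (ideal_pow I (k - c)) N x.
Proof.
move=> noeR Ni; have Ii : is_ideal I := span_ideal z (ideal_set0 R).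
have zI : {in z, forall x, I x} by move=> x; exact: span_mem (ideal_set0 R).
have [|c cP] := @ladder_stable R (size z) (lead z N) noeR.
  split=> [al|al ga sal sga]; first exact: lead_ideal.
  by apply: lead_mono; [rewrite sga|move=> x; exact: idealMr].
(* A capped exponent vector has degree at most [size z * c], so the remaining monomial lies in the
   power [k - size z * c] of [I]. *)
exists (size z * c)%N => k; set M := ideal_mul _ N.
have Mi : is_ideal M by exact: ideal_mul_ideal.
suff h q p : monos (size z) k = p ++ q -> forall x, N x ->
    span [set 0] [seq mon z al | al <- q] x -> M x.
  by move=> x Nx; rewrite ideal_pow_monos; exact: (h _ [::]).
elim: q p => [|al q IH] p e x Nx; first by move=> ->; exact: ideal0.
move=> [a sa].
have : al \in monos (size z) k by rewrite e mem_cat inE eqxx orbT.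
rewrite mem_monos => /andP[/eqP sal /eqP suma].
have st y : span [set 0] [seq mon z be | be <- q] y <-> span [set 0] (tails z al) y.
  exact: span_tails e.
have : lead z N al a.
  by exists (x - a * mon z al); [exact/st|rewrite addrC subrK].
rewrite (cP _ sal) => -[y sy Ny].
pose al' := [seq minn c a | a <- al]; pose ga := [seq (a - c)%N | a <- al].
have sag : size al' = size ga by rewrite !size_map.
have ale : addm al' ga = al by exact: addm_minn.
set w := _ + y in Ny.
have wE : w * mon z ga = a * mon z al + y * mon z ga.
  by rewrite /w mulrDl -mulrA -mon_addm// -/al' ale.
have Mw : M (w * mon z ga).
  rewrite mulrC; apply: ideal_mul_mem => //.
  have : ideal_pow I (sumn ga) (mon z ga) by apply: mon_pow => //; rewrite size_map.
  apply: ideal_pow_sub; rewrite -suma -ale sumn_addm// leq_subLR leq_add2r.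
  rewrite -sal /al'; elim: (al) => //= b be IHb.
  by rewrite mulSn leq_add ?geq_minl.
rewrite -(subrK (w * mon z ga) x); apply: (idealD Mi _ Mw); apply: (IH (rcons p al)).
- by rewrite cat_rcons.
- exact: (idealB Ni Nx (idealMr _ Ni Ny)).
- rewrite wE opprD addrA; apply: idealB => //; first exact: span_ideal (ideal_set0 R).
  by apply/st; rewrite -ale; exact: tails_addm.
Qed.

(** If [x * b - p] is in [I^n] with [p] in [P], Artin-Rees for [P + (b)] makes it congruent to
    [y * b] modulo [P] with [y] in [I^(n - c)]; then [b] cancels modulo the prime [P]. *)
Lemma prime_colon_pow z P b (I := span [set 0] z) : noetherian R ->
    is_prime_ideal P -> ~ P b ->
  exists c, forall n, colon (isum P (ideal_pow I n)) b `<=` isum P (ideal_pow I (n - c)).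
Proof.
move=> noeR [Pi P1 Pp] Pb.
have [c cP] := artin_rees z noeR (adj_ideal b Pi).
exists c => n x [p Pp' Ip].
have Ai := @ideal_pow_ideal R I (n - c)%N.
have : [set v | exists2 y, ideal_pow I (n - c) y & P (v - y * b)] (x * b - p).
  apply: (@ideal_mul_min _ (ideal_pow I (n - c)) (adj b P)); last 2 first.
  - move=> u v Iu [e Pe]; exists (u * e); first exact: idealMr.
    by rewrite -mulrA -mulrBr; exact: idealMl.
  - apply: cP => //; exists x; rewrite addrAC subrr add0r; exact: idealN.
  split; first by exists 0; [exact: ideal0|rewrite mul0r subr0; exact: ideal0].
  - move=> u v [y Iy Py] [y' Iy' Py']; exists (y + y'); first exact: idealD.
    by rewrite mulrDl opprD addrACA; exact: idealD.
  - move=> r u [y Iy Py]; exists (r * y); first exact: idealMl.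
    by rewrite -mulrA -mulrBr; exact: idealMl.
move=> [y Iy Py].
have : P ((x - y) * b).
  rewrite mulrBl -(subrK p (x * b - y * b)); apply: (idealD Pi _ Pp').
  by rewrite addrAC.
move=> /Pp[Pxy|//]; exists (x - y) => //; by rewrite subKr.
Qed.

Definition prime_chain (k : nat) (P : nat -> set R) :=
  (forall i, (i <= k)%N -> is_prime_ideal (P i)) /\
  (forall i, (i < k)%N -> P i `<` P i.+1).

(* An element of [P 1] outside [P 0] makes the colengths modulo [P 0] grow one
   degree faster than those modulo [P 1], by Artin-Rees. *)
Lemma prime_chain_growth z k (P : nat -> set R) (I := span [set 0] z) :
    noetherian R -> flen setT I -> prime_chain k P -> ~ isum (P k) I 1 ->
  exists2 c, (0 < c)%N &
    forall n, ('C(n, k) <= len setT (isum (P 0%N) (ideal_pow I (c * n.+1))))%N.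
Proof.
move=> noeR fl; have Ii : is_ideal I := span_ideal z (ideal_set0 R).
have Ini n := @ideal_pow_ideal R I n.
have flP Q n : is_ideal Q -> flen setT (isum Q (ideal_pow I n)).
  by move=> Qi; apply: flen_sub (flen_pow fl n).1 => //; exact: isum_r.
elim: k P => [|k IH] P [Pp PS] prop.
  have [Pi P1 _] := Pp 0%N (leqnn _).
  exists 1%N => // m; rewrite bin0 mul1n; apply: len_gt0; rewrite ?flP//.
  - exact: isum_ideal.
  - split=> // h; apply: prop.
    have : isum (P 0%N) (ideal_pow I m.+1) 1 by exact: h.
    apply: isum_mono => //; rewrite -{2}(ideal_pow1 Ii); exact: ideal_pow_sub.
  - exact: flP.
have [||c1 c1_gt0 c1P] := IH (fun i => P i.+1).
- by split=> i ik; [exact: Pp|exact: PS].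
- by [].
have [P01 /existsNP[b /not_implyP[P1b P0b]]] := PS 0%N isT.
have [P0i _ _] := Pp 0%N isT; have [P1i _ _] := Pp 1%N isT.
have [c0 c0P] := prime_colon_pow z noeR (Pp 0%N isT) P0b.
(* This is at least [c1], for the bound modulo [P 1], and at least [c0], so that the Artin-Rees loss
   costs at most one step of [n]. *)
exists (c1 * c0.+1)%N => [|m]; first by rewrite muln_gt0 c1_gt0.
set c := (c1 * c0.+1)%N.
pose g n := len setT (isum (P 0%N) (ideal_pow I (c * n))).
(* The length of [R / A] splits: [R / (A + (b))] surjects onto the quotient modulo [P 1] and a power
   of [I], giving the binomial; [(A + (b)) / A] has the length of [R / (A : b)], which surjects onto
   the quotient measured by [g n]. *)
have gS n : (g n + 'C(n, k) <= g n.+1)%N.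
  pose A := isum (P 0%N) (ideal_pow I (c * n.+1)).
  have Ai : is_ideal A by exact: isum_ideal.
  have Bi := adj_ideal b Ai.
  rewrite /g (len_add Ai Bi)//; [|exact: adj_sub|exact: flP].
  rewrite addnC; apply: leq_add.
    apply: leq_trans (c1P n) _; apply: len_antitone => //; first exact: isum_ideal.
      apply: adj_min; [exact: isum_ideal|exact: isum_l|].
      by apply: isum_mono => //; apply: ideal_pow_sub; rewrite leq_mul2r leq_pmulr// orbT.
    by apply: flen_sub (flP _ (c * n.+1)%N P0i) => //; exact: adj_sub.
  rewrite (len_adj b Ai).2; apply: len_antitone => //.
  - exact: colon_ideal.
  - exact: isum_ideal.
  - apply: subset_trans (c0P _) _; apply: isum_mono => //; apply: ideal_pow_sub.
    have c0c : (c0 <= c)%N by rewrite -[leqLHS]mul1n leq_mul.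
    by rewrite mulnS addnC -addnBA ?leq_addr.
  - apply: flen_sub (flP _ (c * n.+1)%N P0i) => // x Ax.
    by rewrite /colon /=; exact: idealMr.
have gb n : ('C(n, k.+1) <= g n)%N.
  elim: n => [|n IHn]; first by [].
  by rewrite binS; apply: leq_trans (gS n); rewrite leq_add2r.
by apply: leq_trans (gb _); exact: leq_bin2l.
Qed.

Lemma bin_poly_le (k D B : nat) : (forall n, 'C(n, k) <= B * n.+1 ^ D)%N -> (k <= D)%N.
Proof.
move=> h; rewrite leqNgt; apply/negP => Dk.
(* Evaluation at [n = t + k]: as [t > k], the base [t + k + 1] is at most [2 t], so the hypothesis
   gives [t^k <= X t^D]; but [t > X]. *)
pose X := (k`! * B * 2 ^ D)%N; pose t := (X + k.+1)%N.
have : (t ^ k <= k`! * (B * (t + k).+1 ^ D))%N.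
  apply: leq_trans (leq_mul (leqnn _) (h (t + k)%N)).
  rewrite mulnC bin_ffact ffact_prod -[in leqLHS](card_ord k) -prod_nat_const.
  by apply: leq_prod => i _; have := ltn_ord i; lia.
apply/negP; rewrite -ltnNge.
apply: (@leq_ltn_trans (X * t ^ D)%N).
  rewrite /X -!mulnA !leq_mul2l -expnMn; apply/orP; right; apply/orP; right.
  by case: (D) => // D'; rewrite leq_exp2r//; rewrite /t; lia.
apply: (@leq_trans (t ^ D.+1)%N); last by rewrite leq_pexp2l// /t; lia.
by rewrite expnS ltn_pmul2r ?expn_gt0 /t; lia.
Qed.

(** Colengths modulo [P 0] grow at least with degree [k] because of the chain and at most with
    degree [s + 1] because of the number of generators. *)
Lemma prime_chain_le z s k (P : nat -> set R) (I := span [set 0] z) :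
    noetherian R -> size z = s.+1 -> flen setT I -> prime_chain k P ->
  ~ isum (P k) I 1 -> (k <= s.+1)%N.
Proof.
move=> noeR sz fl Pc prop; have Ii : is_ideal I := span_ideal z (ideal_set0 R).
have [c c_gt0 cP] := prime_chain_growth noeR fl Pc prop.
apply: (@bin_poly_le _ _ (len setT I * c ^ s.+1)) => n.
apply: leq_trans (cP n) _; rewrite -mulnA -expnMn.
apply: leq_trans (len_pow_le sz fl _).
have [P0i _ _] := Pc.1 0%N isT.
apply: len_antitone => //; [exact: ideal_pow_ideal| |exact: isum_r|].
  by apply: isum_ideal => //; exact: ideal_pow_ideal.
exact: (flen_pow fl _).1.
Qed.

Lemma flen_maximal m : is_maximal_ideal m -> flen setT m.
Proof.
move=> [mi m1 mmax]; exists 1%N => -[|[|n]]// [c [cF cS]]; exfalso.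
have [_ mc0 _] := cF 0%N isT; have [c1i mc1 _] := cF 1%N isT.
have [_ n01] := cS 0%N isT; have [_ n12] := cS 1%N isT.
apply: n01; rewrite (mmax (c 1%N))// => c11; apply: n12.
by rewrite (ideal1 c1i).
Qed.

Lemma noetherian_span I : noetherian R -> is_ideal I -> exists z, I = span [set 0] z.
Proof. by move=> noeR /noeR[z ->]; exists z; rewrite ideal_gen_span. Qed.

Lemma flen_of_pow m I r : noetherian R -> local_ring m -> ideal_pow m r `<=` I ->
  flen setT I.
Proof.
move=> noeR locR mI.
have [[mi _ _] _] := locR; have [z mz] := noetherian_span noeR mi.
have [] := @flen_pow z _ r; last by rewrite -mz => + _; apply: flen_sub.
by rewrite -mz; apply: flen_maximal; case: locR.
Qed.

Lemma flen_primary m I : noetherian R -> local_ring m -> m_primary m I -> flen setT I.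
Proof.
move=> noeR locR Ip; have [r mI] := m_primary_pow noeR locR Ip.
exact: flen_of_pow mI.
Qed.

End HilbertSamuel.

(** * Power series *)

Section PowerSeries.
Variable R : comNzRingType.
(* Unqualified, [pseries] is that of MathComp-Analysis. *)
Local Notation S := (Defs.pseries R).
Implicit Types (f g h : S) (J : set S) (m : set R).

Definition pXn n : S := fun k => (k == n)%:R.
Definition pC (c : R) : S := fun k => if k == 0%N then c else 0.
Definition pdrop n f : S := fun k => f (n + k)%N.

Lemma pcoefM f g n : (f * g) n = \sum_(i < n.+1) f i * g (n - i)%N.
Proof. by []. Qed.

Lemma pcoefD f g n : (f + g) n = f n + g n.
Proof. by []. Qed.

Lemma pcoefB f g n : (f - g) n = f n - g n.
Proof. by []. Qed.

Lemma pcoef1 n : (1 : S) n = (n == 0%N)%:R.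
Proof. by []. Qed.

Lemma pcoef_sum (T : Type) (r : seq T) (P : pred T) (F : T -> S) n :
  (\sum_(i <- r | P i) F i) n = \sum_(i <- r | P i) F i n.
Proof.
by apply: (big_morph (fun f : S => f n)).
Qed.

Lemma pcoef0M f g : (f * g) 0%N = f 0%N * g 0%N.
Proof. by rewrite pcoefM big_ord_recl big_ord0 addr0. Qed.

Lemma pcoefXnM n f k : (pXn n * f) k = if (k < n)%N then 0 else f (k - n)%N.
Proof.
rewrite pcoefM; case: ltnP => h.
  rewrite big1// => i _; rewrite /pXn (_ : (i == n :> nat) = false) ?mul0r//.
  by apply/negbTE; rewrite neq_ltn (leq_trans (ltn_ord i)).
rewrite (bigD1 (Ordinal (h : (n < k.+1)%N)))//= /pXn eqxx mul1r big1 ?addr0// => i ne.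
by rewrite (_ : (i == n :> nat) = false) ?mul0r//; apply/negbTE.
Qed.

Lemma pcoefCM c f k : (pC c * f) k = c * f k.
Proof.
rewrite pcoefM big_ord_recl /pC /= subn0 big1 ?addr0// => i _.
by rewrite mul0r.
Qed.

Lemma pXn0 : pXn 0%N = 1.
Proof. by []. Qed.

Lemma pXnD n k : pXn (n + k)%N = pXn n * pXn k.
Proof.
apply/funext => i; rewrite pcoefXnM /pXn; case: ltnP => h.
  by rewrite (_ : (i == _) = false)//; apply/negbTE; rewrite neq_ltn (leq_trans h)// leq_addr.
by congr (_%:R); congr nat_of_bool; lia.
Qed.

Lemma pdropK n f : (forall k, (k < n)%N -> f k = 0) -> f = pXn n * pdrop n f.
Proof.
move=> f0; apply/funext => k; rewrite pcoefXnM; case: ltnP => [/f0//|h].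
by rewrite /pdrop subnKC.
Qed.

Lemma pdrop1K f : f 0%N = 0 -> f = pXn 1%N * pdrop 1%N f.
Proof. by move=> f0; apply: pdropK => -[]. Qed.

Lemma pCD : {morph pC : x y / x + y}.
Proof. by move=> x y; apply/funext => -[|k]; rewrite pcoefD /pC//= addr0. Qed.

Lemma pCM : {morph pC : x y / x * y}.
Proof. by move=> x y; apply/funext => -[|k]; rewrite pcoefCM /pC//= mulr0. Qed.

Lemma pC0 : pC 0 = 0.
Proof. by apply/funext => -[|k]. Qed.

Lemma pC1 : pC 1 = 1.
Proof. by apply/funext => -[|k]. Qed.

Lemma pCX c n : pC c ^+ n = pC (c ^+ n).
Proof. by elim: n => [|n IH]; rewrite ?expr0 ?pC1// !exprS pCM IH. Qed.

(* Division carried out one degree at a time; the quotients converge because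
   the ring is [T]-adically complete. *)
Lemma series_division r (fs : 'I_r -> S) (E : nat -> set S) :
    (forall i g, E i g -> exists c : 'I_r -> R, exists2 g', E i.+1 g' &
       g = \sum_j pC (c j) * fs j + pXn 1%N * g') ->
  forall g, E 0%N g -> exists h : 'I_r -> S, g = \sum_j h j * fs j.
Proof.
move=> step g Eg.
have /choice[Phi PhiP] (p : nat * S) : exists q : ('I_r -> R) * S, E p.1 p.2 ->
    E p.1.+1 q.2 /\ p.2 = \sum_j pC (q.1 j) * fs j + pXn 1%N * q.2.
  have [/step[c [g' Eg' ge]]|no] := pselect (E p.1 p.2); first by exists (c, g').
  by exists (fun=> 0, 0).
pose G := fix G n := if n is n'.+1 then (Phi (n', G n')).2 else g.
pose c i := (Phi (i, G i)).1.
have GE i : E i (G i) by elim: i => // i IH; case: (PhiP (i, G i) IH).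
have Gstep i : G i = \sum_j pC (c i j) * fs j + pXn 1%N * G i.+1.
  by case: (PhiP (i, G i) (GE i)).
have Gsum n : g = \sum_j (\sum_(i < n) pXn i * pC (c i j)) * fs j + pXn n * G n.
  elim: n => [|n IH].
    rewrite big1 ?add0r ?pXn0 ?mul1r// => j _.
    by rewrite big_ord0 mul0r.
  rewrite [LHS]IH [in LHS](Gstep n) mulrDr addrA [pXn n * (pXn 1%N * _)]mulrA -pXnD addn1.
  congr (_ + _).
  rewrite mulr_sumr -big_split /=; apply: eq_bigr => j _.
  by rewrite big_ord_recr /= mulrDl mulrA.
(* The coefficient at [T^k] is settled by the first [k + 1] divisions, since the remainder after
   them is divisible by [T^(k + 1)]. *)
exists (fun j => (fun i => c i j) : S); apply/funext => k.
rewrite {1}(Gsum k.+1) pcoefD pcoefXnM ltnSn addr0 !pcoef_sum.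
apply: eq_bigr => j _; rewrite !pcoefM; apply: eq_bigr => i _; congr (_ * _).
rewrite pcoef_sum (bigD1 i)//= pcoefXnM ltnn subnn /pC /= big1 ?addr0// => l ne.
rewrite pcoefXnM; case: ltnP => // li; rewrite ifN// subn_eq0 -ltnNge.
by rewrite ltn_neqAle li andbT.
Qed.

Lemma pseries_unit f u : u * f 0%N = 1 -> exists h, h * f = 1.
Proof.
move=> uf; have [|//|h he] := @series_division 1%N (fun=> f) (fun=> setT) _ 1.
  move=> i g _; exists (fun=> g 0%N * u).
  pose d : S := g - pC (g 0%N * u) * f.
  have d0 : d 0%N = 0 by rewrite /d pcoefB pcoefCM -mulrA uf mulr1 subrr.
  by exists (pdrop 1%N d) => //; rewrite big_ord1 -(pdrop1K d0) addrC subrK.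
by exists (h ord0); rewrite he big_ord1.
Qed.

(* The coefficients at [T ^ i] of the elements of [J] divisible by [T ^ i]. *)
Definition ld J i : set R := [set c | exists2 f, f 0%N = c & J (pXn i * f)].

Lemma ld_ideal J i : is_ideal J -> is_ideal (ld J i).
Proof.
move=> Ji; split.
- by exists 0 => //; rewrite mulr0; exact: ideal0.
- move=> a b [f fa Jf] [g gb Jg]; exists (f + g); first by rewrite pcoefD fa gb.
  by rewrite mulrDr; exact: idealD.
- move=> r a [f fa Jf]; exists (pC r * f); first by rewrite pcoefCM fa.
  by rewrite mulrCA; exact: idealMl.
Qed.

Lemma ld_sub J i k : is_ideal J -> (i <= k)%N -> ld J i `<=` ld J k.
Proof.
move=> Ji /subnK <- c [f fc Jf]; exists f => //.
by rewrite pXnD -mulrA; exact: idealMl.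
Qed.

Lemma span_sum (T : comNzRingType) (s : seq T) x : span [set 0] s x ->
  exists a : 'I_(size s) -> T, x = \sum_j a j * s`_j.
Proof.
elim: s x => [|z s IH] x /=; first by move=> ->; exists (fun=> 0); rewrite big_ord0.
move=> [c /IH[a xe]].
exists (fun j => if unlift ord0 j is Some j' then a j' else c).
rewrite big_ord_recl unlift_none /= -[LHS](subrK (c * z)) xe addrC; congr (_ + _).
by apply: eq_bigr => j _; rewrite liftK.
Qed.

(** Lifts [fs] of generators of [ld J i] cancel the constant term of [g] without leaving [J].
    Allowing every [k >= i] with the same leading ideal serves both a single degree and the whole
    stable range. *)
Lemma ld_step J i : noetherian R -> is_ideal J ->
  exists r (fs : 'I_r -> S), (forall j, J (pXn i * fs j)) /\
    forall k g, (i <= k)%N -> ld J k = ld J i -> J (pXn k * g) ->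
      exists c : 'I_r -> R, exists2 g', J (pXn k.+1 * g') &
        g = \sum_j pC (c j) * fs j + pXn 1%N * g'.
Proof.
move=> noeR Ji; have [cs csE] := noetherian_span noeR (ld_ideal i Ji).
have /choice[fs fsP] (j : 'I_(size cs)) : exists f : S, f 0%N = cs`_j /\ J (pXn i * f).
  have : ld J i cs`_j by rewrite csE; apply: span_mem; [exact: ideal_set0|exact: mem_nth].
  by move=> [f fj Jf]; exists f.
exists (size cs), fs; split=> [j|k g ik ldk Jg]; first by case: (fsP j).
have : ld J i (g 0%N) by rewrite -ldk; exists g.
rewrite csE => /span_sum[a ga]; exists a.
pose d : S := g - \sum_j pC (a j) * fs j.
have d0 : d 0%N = 0.
  rewrite /d pcoefB pcoef_sum ga -sumrB big1// => j _.
  by rewrite pcoefCM (fsP j).1 subrr.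
exists (pdrop 1%N d); last by rewrite -(pdrop1K d0) addrC subrK.
rewrite -addn1 pXnD -mulrA -(pdrop1K d0) mulrBr; apply: idealB => //.
rewrite mulr_sumr; apply: ideal_sum => // j; rewrite -(subnK ik) pXnD mulrCA -mulrA.
by apply: idealMl => //; apply: idealMl => //; case: (fsP j).
Qed.

(** From the degree [N] where the leading ideals stabilize, one set of lifts generates by
    [series_division]. Each lower degree adds lifts of its own, by descending induction on
    [i = N - k]. *)
Lemma pseries_noetherian : noetherian R -> noetherian S.
Proof.
move=> noeR J Ji.
have [n|n|N NP] := noetherian_acc (F := ld J) noeR; [exact: ld_ideal|exact: ld_sub|].
suff h i : (i <= N)%N -> exists s : seq S, {in s, forall f, J f} /\
    forall g, J (pXn i * g) -> span [set 0] s (pXn i * g).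
  have [s [sJ sP]] := h 0%N (leq0n _).
  exists s; rewrite ideal_gen_span; apply/seteqP; split.
    by move=> g Jg; have := sP g; rewrite pXn0 mul1r; exact.
  by apply: span_min => // _ ->; exact: ideal0.
move=> /subKn <-; elim: (N - i)%N => [|k IH].
  rewrite subn0; have [r [fs [fsJ fsP]]] := ld_step N noeR Ji.
  exists [seq pXn N * fs j | j <- enum 'I_r]; split=> [_ /mapP[j _ ->]//|g Jg].
  have [||h ->] := @series_division r fs (fun i => [set g | J (pXn (N + i)%N * g)]) _ g.
  - move=> l g' Jg'; have [||c [g'' ? ?]] := fsP (N + l)%N g' _ _ Jg'.
    + exact: leq_addr.
    + by rewrite NP// leq_addr.
    + by exists c; exists g'' => //=; rewrite addnS.
  - by rewrite /= addn0.
  rewrite mulr_sumr; apply: ideal_sum; first exact: span_ideal (ideal_set0 _).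
  move=> j; rewrite mulrCA; apply: idealMl; first exact: span_ideal (ideal_set0 _).
  apply: span_mem; first exact: ideal_set0.
  by apply: map_f; rewrite mem_enum.
have [Nk|kN] := leqP N k.
  by move: IH; rewrite (eqP Nk) (_ : (N - k.+1 = 0)%N)//; lia.
have [s [sJ sP]] := IH.
have [r [fs [fsJ fsP]]] := ld_step (N - k.+1)%N noeR Ji.
exists ([seq pXn (N - k.+1)%N * fs j | j <- enum 'I_r] ++ s); split=> [f|g Jg].
  by rewrite mem_cat => /orP[/mapP[j _ ->]//|/sJ].
have [//||c [g' Jg' ->]] := fsP _ g _ _ Jg; first by [].
rewrite -subSn// subSS in Jg'.
have Si := span_ideal ([seq pXn (N - k.+1)%N * fs j | j <- enum 'I_r] ++ s) (ideal_set0 S).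
rewrite mulrDr mulr_sumr; apply: idealD => //.
  apply: ideal_sum => // j; rewrite mulrCA; apply: idealMl => //.
  apply: span_mem; first exact: ideal_set0.
  by rewrite mem_cat; apply/orP; left; apply: map_f; rewrite mem_enum.
rewrite mulrA -pXnD addn1 -subSn// subSS.
apply: (@span_mono _ [set 0] s [set 0]) (sP _ Jg') => //; first exact: ideal_set0.
by move=> f fs'; rewrite mem_cat fs' orbT.
Qed.

Lemma coef0_surj (I : set R) : is_ideal I ->
  is_ideal [set f : S | I (f 0%N)] /\
  ((flen setT [set f : S | I (f 0%N)] <-> flen setT I) /\
   len setT [set f : S | I (f 0%N)] = len setT I).
Proof.
apply: (@len_surj S R (fun f => f 0%N) pC) => //; first exact: pcoef0M.
Qed.

Lemma pseries_local m : noetherian R -> local_ring m ->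
  local_ring [set f : S | m (f 0%N)].
Proof.
move=> noeR locR; have [[mi m1 mmax] _] := locR.
have [m'i _] := coef0_surj mi.
have prop J : is_ideal J -> ~ J 1 -> J `<=` [set f : S | m (f 0%N)].
  move=> Ji J1 f Jf /=; apply: contrapT => mf.
  (* The principal ideal of the constant term is either proper, hence inside [m], or the whole ring;
     in the latter case [f] is a unit. *)
  have [h|/contrapT[u]] := pselect (~ adj (f 0%N) [set 0] 1).
    apply: mf; apply: (proper_sub_maximal noeR locR _ h).
      exact: adj_ideal (ideal_set0 _).
    exact: adj_mem (ideal_set0 _).
  move=> /subr0_eq /esym /pseries_unit[g gf]; apply: J1.
  by rewrite -gf; exact: idealMl.
split.
  split=> // J Ji J1 mJ; apply/seteqP; split=> //; exact: prop.
move=> M [Mi M1 Mmax]; apply/esym; apply: Mmax => //.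
exact: prop.
Qed.

End PowerSeries.

(** * Dimension *)

Section Dimension.
Variable R : comNzRingType.
Implicit Types (m P Q : set R) (z : seq R).

Lemma krull_dimE d : has_krull_dim R d -> krull_dim R = d.
Proof.
move=> [cd mxd]; rewrite /krull_dim; case: xgetP => [k _ [ck mxk]|/(_ d)[]//].
by apply/eqP; rewrite eqn_leq mxd// mxk.
Qed.

Lemma prime_proper_sub m P : noetherian R -> local_ring m -> is_prime_ideal P -> P `<=` m.
Proof. by move=> noeR locR [Pi P1 _]; exact: (proper_sub_maximal noeR locR). Qed.

Lemma prime_chain_rcons k (c : nat -> set R) Q : prime_chain k c -> is_prime_ideal Q ->
    c k `<` Q ->
  exists2 c', prime_chain k.+1 c' & c' k.+1 = Q.
Proof.
move=> [Pp PS] Qp PQ; exists (fun i => if (i <= k)%N then c i else Q); last first.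
  by rewrite ltnn.
split=> i ik; first by case: ifP => // /Pp.
move: ik; rewrite ltnS => ik; rewrite ik; move: ik; rewrite leq_eqVlt => /orP[/eqP ->|ik].
  by rewrite ltnn.
by rewrite ik; exact: PS.
Qed.

(** In other words, primes containing [z] and different from [m] have height at least [i]. The next
    element avoids every prime other than [m] in the decomposition of [(z)], so a prime containing
    it strictly contains one of these. *)
Lemma partial_parameters m i : noetherian R -> local_ring m ->
  exists z, [/\ size z = i, {in z, forall x, m x} &
    forall P, is_prime_ideal P -> span [set 0] z `<=` P ->
      P = m \/ exists2 c, prime_chain i c & c i = P].
Proof.
move=> noeR locR; have [mM _] := locR; have [mi m1 mmax] := mM.
elim: i => [|i [z [sz zm zP]]].
  exists [::]; split=> [//|x|P Pp _]; first by rewrite in_nil.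
  by right; exists (fun=> P) => //; split.
have Zi := span_ideal z (ideal_set0 R).
have [Ps [Psp PsZ]] := prime_decomposition noeR Zi.
pose Qs := [seq P <- Ps | P != m].
have [|a ma aQ] := @prime_avoidance R m Qs mi.
  move=> P; rewrite mem_filter => /andP[/eqP Pm /Psp[Pp _]]; split=> // mP; apply: Pm.
  by apply/seteqP; split=> //; exact: (prime_proper_sub noeR locR).
exists (a :: z); split=> [|x|P Pp zaP]; first by rewrite /= sz.
  by rewrite inE => /orP[/eqP ->|/zm].
have [Pm|Pm] := pselect (P = m); [by left|right].
have Pi : is_ideal P by case: Pp.
have zsub : span [set 0] z `<=` P by apply: subset_trans zaP; exact: adj_sub.
have [Q Qs' QP] := prime_of_product Pp (subset_trans PsZ zsub).
have [Qp zQ] := Psp _ Qs'.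
have Qm : Q <> m.
  move=> Qm; apply: Pm; apply/seteqP; split; first exact: (prime_proper_sub noeR locR).
  by rewrite -Qm.
have [//|[c cc ci]] := zP Q Qp zQ.
apply: (prime_chain_rcons cc Pp); rewrite ci; split=> // PQ.
apply: (aQ Q); first by rewrite mem_filter Qs' andbT; apply/eqP.
by apply: PQ; apply: zaP; exact: adj_mem.
Qed.

(** A prime containing [z] other than [m] would end a chain of length [d], which [m] would extend
    beyond the dimension. So only [m] contains [z], and the prime decomposition of [(z)] is a power
    of [m]. *)
Lemma parameters m d : noetherian R -> local_ring m -> has_krull_dim R d ->
  exists z, [/\ size z = d, {in z, forall x, m x} &
    exists r, ideal_pow m r `<=` span [set 0] z].
Proof.
move=> noeR locR [_ mxd]; have [mM _] := locR.
have [z [sz zm zP]] := partial_parameters d noeR locR.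
exists z; split=> //.
have Zi := span_ideal z (ideal_set0 R).
have [Ps [Psp PsZ]] := prime_decomposition noeR Zi.
exists (size Ps); rewrite -foldr_mul_pow// => P /Psp[Pp zsub].
have [//|[c cc ci]] := zP P Pp zsub; apply: contrapT => Pm.
have Psm := prime_proper_sub noeR locR Pp.
have [|c' cc' _] := prime_chain_rcons cc (maximal_prime mM).
  by rewrite ci; split=> // mP; apply: Pm; apply/seteqP.
by have := mxd d.+1; rewrite ltnn => h; have := h (ex_intro _ c' cc').
Qed.

Local Notation S := (Defs.pseries R).

Lemma coef_prime P : is_prime_ideal P -> is_prime_ideal [set f : S | P (f 0%N)].
Proof.
move=> [Pi P1 Pp]; have [Qi _] := coef0_surj Pi; split=> // f g /=.
by rewrite pcoef0M => /Pp.
Qed.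

(** If [i] and [j] are the first positions where [f] and [g] leave [P], the coefficient of [f * g]
    at [i + j] is [f i * g j] modulo [P]. *)
Lemma coefs_prime P : is_prime_ideal P -> is_prime_ideal [set f : S | forall k, P (f k)].
Proof.
move=> [Pi P1 Pp]; split.
- split=> /= [k|f g Pf Pg k|f g Pg k]; first exact: ideal0.
    exact: idealD.
  by rewrite pcoefM; apply: ideal_sum => // i; exact: idealMl.
- by move=> /(_ 0%N).
- move=> f g /= Pfg; apply: contrapT => /not_orP[].
  have least h : ~ (forall k, P (h k)) -> exists i, ~ P (h i) /\
      forall k, (k < i)%N -> P (h k).
    move=> /existsNP[k Pk].
    have ex : exists k, ~~ `[< P (h k) >] by exists k; apply/asboolPn.
    case: (ex_minnP ex) => i /asboolPn Pi' mini; exists i; split=> // l li.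
    apply: contrapT => Pl; move: li; rewrite ltnNge => /negP; apply.
    by apply: mini; apply/asboolPn.
  move=> /least[i [Pfi Pfl]] /least[j [Pgj Pgl]].
  have := Pfg (i + j)%N; rewrite pcoefM.
  have ij : (i < (i + j).+1)%N by rewrite ltnS leq_addr.
  rewrite (bigD1 (Ordinal ij))//= addKn => Ps.
  have : P (f i * g j).
    rewrite -(addrK (\sum_(l < (i + j).+1 | l != Ordinal ij) f l * g (i + j - l)%N) (f i * g j)).
    apply: idealB => //; apply: big_ind => [|x y|l ne]; [exact: ideal0|exact: idealD|].
    have {}ne : (l : nat) != i by [].
    have [li|il] := ltnP l i; first by apply: idealMr => //; exact: Pfl.
    apply: idealMl => //; apply: Pgl; have := ltn_ord l; lia.
  by move=> /Pp[].
Qed.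

Lemma pseries_krull_dim m d : noetherian R -> local_ring m ->
  has_krull_dim R d -> has_krull_dim S d.+1.
Proof.
move=> noeR locR dimR; have [[[mi m1 mmax] _] [[P [Pp PS]] _]] := (locR, dimR).
have noeS := pseries_noetherian noeR; have locS := pseries_local noeR locR.
split.
  (* The chain is [P_0[[T]]], then [P_0 + (T)], ..., [P_d + (T)]; its first step is strict because
     of [T]. *)
  exists (fun i => if i is i'.+1 then [set f : S | P i' (f 0%N)]
                 else [set f : S | forall k, P 0%N (f k)]).
  split=> [[|i]|[|i]]; rewrite ?ltnS => h.
  - by apply: coefs_prime; exact: Pp.
  - by apply: coef_prime; exact: Pp.
  - have [Pi P1 _] := Pp 0%N isT; split=> [f Pf|]; first exact: Pf.
    move=> /(_ (pXn R 1%N)) h'; apply: P1; have := h' _ 1%N; rewrite /= /pXn /=; apply.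
    exact: ideal0.
  - have [PP nPP] := PS _ h; split=> [f|h']; first exact: PP.
    by apply: nPP => c Pc; have := h' (pC c); apply.
have [z [sz zm [r mz]]] := parameters noeR locR dimR.
move=> k [Q [Qp QS]].
(* [T] and the parameters of [R] are [d + 1] elements generating an ideal of finite colength, so
   [prime_chain_le] bounds every chain of primes by [d + 1]. *)
pose y := pXn R 1%N :: map (@pC R) z.
have sy : size y = d.+1 by rewrite /= size_map sz.
have Yi := span_ideal y (ideal_set0 S).
have Zi := span_ideal z (ideal_set0 R).
apply: (@prime_chain_le S y d k Q noeS sy) => //.
  have [_ [[_ fl] _]] := coef0_surj Zi.
  apply: flen_sub (fl (flen_of_pow noeR locR mz)) => // f fz.
  have Cz : span [set 0] z `<=` [set c | span [set 0] y (pC c)].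
    apply: span_min.
    - split=> /=; first by rewrite pC0; exact: ideal0.
      + by move=> a b ha hb; rewrite pCD; exact: idealD.
      + by move=> a b hb; rewrite pCM; exact: idealMl.
    - move=> x xz; have xy : pC x \in y by rewrite inE map_f ?orbT.
      exact: (span_mem (ideal_set0 S) xy).
    - by move=> _ -> /=; rewrite pC0; exact: ideal0.
  rewrite -(subrK (pC (f 0%N)) f); apply: idealD => //; last exact: Cz.
  rewrite (@pdrop1K _ (f - pC (f 0%N))); last by rewrite pcoefB /pC subrr.
  have Xy : pXn R 1%N \in y by rewrite inE eqxx.
  exact: (idealMr _ Yi (span_mem (ideal_set0 S) Xy)).
have [[m'i m'1 _] _] := locS.
move=> h; apply: m'1; apply: (isum_min m'i _ _ h).
  by have [Qi Q1 _] := Qp k (leqnn _); exact: (proper_sub_maximal noeS locS).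
apply: span_min => // [f|_ ->]; last exact: ideal0.
rewrite inE => /orP[/eqP ->|/mapP[x xz ->]]; last exact: zm.
by rewrite /= /pXn; exact: ideal0.
Qed.

End Dimension.

Lemma mpseries_local (R : comNzRingType) (m : set R) d n : noetherian R ->
    local_ring m -> has_krull_dim R d ->
  [/\ noetherian (mpseries R n), exists M, @local_ring (mpseries R n) M &
      has_krull_dim (mpseries R n) (n + d)].
Proof.
move=> noeR locR dimR; elim: n => [|n [noeS [M locS] dimS]].
  by split=> //; exists m.
split.
- exact: (@pseries_noetherian (mpseries R n)).
- by eexists; exact: (@pseries_local (mpseries R n) _ noeS locS).
- exact: (@pseries_krull_dim (mpseries R n) _ _ noeS locS).
Qed.

(** * Normalized limits of eventually polynomial sequences *)

Section Asymptotics.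
Variable K : realType.
Implicit Types u : nat -> K.

Lemma cvg_invn : (fun n : nat => (n%:R : K)^-1) @ \oo --> (0 : K).
Proof. by rewrite -cvg_shiftS; exact: cvg_harmonic. Qed.

Lemma cvgn_sum (q : nat) (f : nat -> nat -> K) (l : nat -> K) :
  (forall i, f i @ \oo --> l i) ->
  (fun n => \sum_(i < q) f i n) @ \oo --> \sum_(i < q) l i.
Proof.
move=> fl; elim: q => [|q IH].
  rewrite big_ord0; under eq_fun do rewrite big_ord0; exact: cvg_cst.
rewrite big_ord_recr /=; under eq_fun do rewrite big_ord_recr /=.
by apply: cvgD.
Qed.

Lemma cvg_subn_div j : (fun n : nat => (n - j)%N%:R / n%:R : K) @ \oo --> (1 : K).
Proof.
have h : (fun n : nat => 1 - j%:R * (n%:R : K)^-1) @ \oo --> (1 - j%:R * 0 : K).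
  apply: cvgB; first exact: cvg_cst.
  by apply: cvgM; [exact: cvg_cst|exact: cvg_invn].
rewrite mulr0 subr0 in h; apply: cvg_trans h; apply: near_eq_cvg.
exists j.+1 => // n /= jn.
have n0 : (n%:R : K) != 0 by rewrite pnatr_eq0; lia.
by rewrite natrB ?(ltnW jn)// mulrBl divff.
Qed.

Lemma cvg_bin N i : (fun n : nat => 'C(n - N, i)%:R / n%:R ^+ i : K) @ \oo --> (i`!%:R^-1 : K).
Proof.
elim: i => [|i IH].
  under eq_fun do rewrite bin0 expr0 divr1.
  by rewrite fact0 invr1; exact: cvg_cst.
have e n : 'C(n - N, i.+1)%:R / n%:R ^+ i.+1 =
    ('C(n - N, i)%:R / n%:R ^+ i) * ((n - (N + i))%N%:R / n%:R) * i.+1%:R^-1 :> K.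
  have := mul_bin_left (n - N) i => /(congr1 (fun k : nat => k%:R : K)).
  rewrite !natrM -subnDA => h.
  have i0 : (i.+1%:R : K) != 0 by rewrite pnatr_eq0.
  have -> : 'C(n - N, i.+1)%:R = i.+1%:R^-1 * ((n - (N + i))%N%:R * 'C(n - N, i)%:R) :> K.
    by rewrite -h mulKf.
  by rewrite exprS invfM; ring.
under eq_fun do rewrite e.
have -> : ((i.+1)`!%:R^-1 : K) = i`!%:R^-1 * 1 * i.+1%:R^-1.
  by rewrite mulr1 factS natrM invfM mulrC.
by apply: cvgM; [apply: cvgM => //; exact: cvg_subn_div|exact: cvg_cst].
Qed.

Lemma cvgn_exp (u : nat -> K) (l : K) k : u @ \oo --> l -> (fun n => u n ^+ k) @ \oo --> l ^+ k.
Proof.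
move=> ul; elim: k => [|k IH].
  by under eq_fun do rewrite expr0; rewrite expr0; exact: cvg_cst.
by under eq_fun do rewrite exprS; rewrite exprS; apply: cvgM.
Qed.

Lemma cvg_bin_lt N i e : (i < e)%N ->
  (fun n : nat => 'C(n - N, i)%:R / n%:R ^+ e : K) @ \oo --> (0 : K).
Proof.
move=> ie; have -> : (0 : K) = i`!%:R^-1 * 0 ^+ (e - i).
  by rewrite expr0n subn_eq0 leqNgt ie mulr0.
have eq n : 'C(n - N, i)%:R / n%:R ^+ e = 'C(n - N, i)%:R / n%:R ^+ i * n%:R^-1 ^+ (e - i) :> K.
  by rewrite exprVn -mulrA -invfM -exprD subnKC// ltnW.
under eq_fun do rewrite eq.
by apply: cvgM; [exact: cvg_bin|apply: cvgn_exp; exact: cvg_invn].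
Qed.

Lemma cvg_natpow_infty k : (0 < k)%N -> (fun n : nat => (n%:R : K) ^+ k) @ \oo --> +oo.
Proof.
move=> k0; apply/cvgryPge => M; near=> n.
have Mn : M <= n%:R by near: n; apply: nbhs_infty_ger.
apply: (le_trans Mn); rewrite -natrX ler_nat -[leqLHS]expn1 leq_pexp2l//.
near: n; exact: nbhs_infty_gt.
Unshelve. all: by end_near. Qed.

(** In the Newton expansion, if no nonzero coefficient has index above [D] the limit is finite.
    Otherwise the one of largest index [e] is positive, because [u] is nonnegative, and the quotient
    grows like [n^(e - D)]. *)
Lemma evp_cvg u (D : nat) : evp u -> (forall n, 0 <= u n) ->
  exists l : \bar K, (fun n => (u n / n%:R ^+ D)%:E) @ \oo --> l.
Proof.
move=> [q [N uP]] u0; have [c cP] := newton_forward_difference uP.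
have uE n : (N <= n)%N -> u n = \sum_(i < q) c i * 'C(n - N, i)%:R.
  by move=> Nn; rewrite -{1}(subnKC Nn) cP; apply: eq_bigr => i _; rewrite mulr_natr.
have lead e : (forall i, (e < i < q)%N -> c i = 0) ->
    (fun n => u n / n%:R ^+ e) @ \oo --> (if (e < q)%N then c e / e`!%:R else 0 : K).
  move=> ce; pose l i := if i == e then c e / e`!%:R else 0 : K.
  have -> : (if (e < q)%N then c e / e`!%:R else 0 : K) = \sum_(i < q) l i.
    case: (ltnP e q) => eq.
      by rewrite (bigD1 (Ordinal eq))//= /l eqxx big1 ?addr0// => i /negbTE ne; rewrite ifF.
    by rewrite big1// => i _; rewrite /l ifF//; apply/negbTE; rewrite neq_ltn (leq_trans (ltn_ord i) eq).
  (* Beyond [q] the value is set to the limit, as [cvgn_sum] asks for convergence at every index. *)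
  pose f i n : K := if (i < q)%N then c i * ('C(n - N, i)%:R / n%:R ^+ e) else l i.
  have fl i : f i @ \oo --> l i.
    rewrite /f; case: (boolP (i < q)%N) => iq; last exact: cvg_cst.
    rewrite /l; case: (eqVneq i e) => [->|ie].
      by apply: cvgM; [exact: cvg_cst|exact: cvg_bin].
    have [ei|ei] := ltnP e i.
      rewrite (ce i) ?ei//; under eq_fun do rewrite mul0r.
      exact: cvg_cst.
    rewrite -(mulr0 (c i)); apply: cvgM; first exact: cvg_cst.
    by apply: cvg_bin_lt; rewrite ltn_neqAle ie.
  have := @cvgn_sum q _ _ fl; apply: cvg_trans; apply: near_eq_cvg; exists N => // n /= Nn.
  by rewrite uE// mulr_suml; apply: eq_bigr => i _; rewrite /f ltn_ord mulrA.
have [all0|] := pselect (forall i, (D < i < q)%N -> c i = 0).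
  exists (if (D < q)%N then c D / D`!%:R else 0 : K)%:E.
  by apply: cvg_EFin; [exact: nearW|exact: lead].
move=> /existsNP[i0 /not_implyP[i0q ci0]].
have ex : exists i, ((D < i < q)%N && (c i != 0)) by exists i0; rewrite i0q; apply/eqP.
have ub i : (D < i < q)%N && (c i != 0) -> (i <= q)%N by move=> /andP[/andP[_ /ltnW]].
case: (ex_maxnP ex ub) => e /andP[/andP[De eq] ce] emax.
have {}lead : (fun n => u n / n%:R ^+ e) @ \oo --> (c e / e`!%:R : K).
  have := lead e; rewrite eq; apply => i /andP[ei iq]; apply/eqP/negPn/negP => ci.
  by have := emax i; rewrite ci iq (ltn_trans De ei) => /(_ isT); rewrite leqNgt ei.
have l_gt0 : 0 < c e / e`!%:R.
  rewrite lt_neqAle eq_sym mulf_neq0 ?invr_neq0 ?pnatr_eq0 -?lt0n ?fact_gt0//=.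
  rewrite -(cvg_lim _ lead)//; apply: limr_ge; first by apply/cvg_ex; eexists; exact: lead.
  by apply: nearW => n; rewrite divr_ge0// exprn_ge0.
exists +oo%E; apply/cvgeryP/cvgryPge => M; near=> n.
have n0 : (0 < n)%N by near: n; exact: nbhs_infty_gt.
have -> : u n / n%:R ^+ D = (u n / n%:R ^+ e) * n%:R ^+ (e - D).
  rewrite -mulrA; congr (_ * _); apply: (@mulfI _ (n%:R ^+ e)).
    by rewrite expf_neq0// pnatr_eq0 -lt0n.
  rewrite mulrA divff ?mul1r; last by rewrite expf_neq0// pnatr_eq0 -lt0n.
  by rewrite -{1}(subnK (ltnW De)) exprD mulfK// expf_neq0// pnatr_eq0 -lt0n.
have h1 : (c e / e`!%:R) / 2 <= u n / n%:R ^+ e.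
  near: n; apply: (cvgr_ge (c e / e`!%:R)) => //.
  by rewrite ltr_pdivrMr// ltr_pMr// ltr1n.
have h2 : `|M| / ((c e / e`!%:R) / 2) <= n%:R ^+ (e - D).
  by near: n; apply: cvgry_ge; apply: cvg_natpow_infty; rewrite subn_gt0.
have p0 : 0 < (c e / e`!%:R) / 2 by rewrite divr_gt0.
apply: (le_trans (ler_norm M)).
rewrite -(mulfVK (lt0r_neq0 p0) `|M|) mulrC; apply: ler_pM => //.
- exact: ltW.
- by rewrite divr_ge0// ltW.
Unshelve. all: by end_near. Qed.

End Asymptotics.

(** * Monotonicity of the Lech-Mumford constant *)

Section LeadingIdeals.
Variable R : comNzRingType.
Local Notation S := (Defs.pseries R).
Implicit Types (J : set S) (m : set R).

(** The quotient of [J + (T^i)] by [J + (T^(i + 1))] is generated by [T^i], and its annihilator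
    depends on constant terms only; lengths over [R[[T]]] thus become lengths over [R]. *)
Lemma colon_adj_pXn J i : is_ideal J ->
  colon (adj (pXn R i.+1) J) (pXn R i) = [set f : S | ld J i (f 0%N)].
Proof.
move=> Ji; apply/seteqP; split=> f.
  move=> [g]; rewrite -addn1 pXnD => Jfg.
  exists (f - g * pXn R 1%N); first by rewrite pcoefB pcoef0M /pXn mulr0 subr0.
  by congr (J _): Jfg; ring.
move=> [g g0 Jg]; exists (pdrop 1%N (f - g)).
have fg : f - g = pXn R 1%N * pdrop 1%N (f - g).
  by apply: pdrop1K; rewrite pcoefB g0 subrr.
move: (pdrop 1%N (f - g)) fg => q /(canRL (subrK g)) ->.
by congr (J _): Jg; rewrite -(addn1 i) pXnD; ring.
Qed.

(** The ideals [J + (T^i)] descend from the whole ring and reach [J] at [i = N]; the [i]-th quotient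
    has the length of [R / ld J i]. *)
Lemma len_ld J N : is_ideal J -> J (pXn R N) -> flen setT J ->
  (forall i, flen setT (ld J i)) /\ len setT J = (\sum_(i < N) len setT (ld J i))%N.
Proof.
move=> Ji JN fl; have Ai i := adj_ideal (pXn R i) Ji.
have AS i : adj (pXn R i.+1) J `<=` adj (pXn R i) J.
  apply: adj_min => //; last exact: adj_sub.
  by rewrite -addn1 pXnD; apply: idealMr => //; exact: adj_mem.
have AE i : adj (pXn R i) J = adj (pXn R i) (adj (pXn R i.+1) J).
  apply/seteqP; split; last by apply: adj_min => //; exact: adj_mem.
  by apply: adj_mono; exact: adj_sub.
have step i : flen setT (ld J i) /\
    len (adj (pXn R i) J) (adj (pXn R i.+1) J) = len setT (ld J i).
  have [flE lE] := len_adj (pXn R i) (Ai i.+1).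
  rewrite colon_adj_pXn// in flE lE.
  have [_ [flE' lE']] := coef0_surj (ld_ideal i Ji).
  rewrite -lE' -lE -AE; split=> //; apply/flE'/flE; rewrite -AE.
  by apply: flen_sub fl => //; exact: adj_sub.
split=> [i|]; first by case: (step i).
have -> : J = adj (pXn R N) J.
  by apply/seteqP; split; [exact: adj_sub|exact: adj_min].
move: (len_refl (@idealT S)) => lenTT.
suff h k : len setT (adj (pXn R k) J) = (\sum_(i < k) len setT (ld J i))%N.
  rewrite h; apply: eq_bigr => i _; congr (len setT (ld _ i)).
  by apply/seteqP; split; [exact: adj_sub|exact: adj_min].
elim: k => [|k IH].
  by rewrite big_ord0 (ideal1 (Ai 0%N))//; exact: adj_mem.
rewrite big_ord_recr /= -IH -(step k).2; apply: len_add => //.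
by apply: flen_sub fl => //; exact: adj_sub.
Qed.

Lemma ld_mul J J' i k a b : ld J i a -> ld J' k b -> ld (ideal_mul J J') (i + k)%N (a * b).
Proof.
move=> [f <- Jf] [g <- Jg]; exists ((f : S) * (g : S)); first exact: pcoef0M.
by rewrite pXnD mulrACA; exact: ideal_mul_mem.
Qed.

Lemma ld_pow J i n : ideal_pow (ld J i) n `<=` ld (ideal_pow J n) (i * n)%N.
Proof.
elim: n => [|n IH]; first by move=> c _; exists (pC c).
rewrite !ideal_powS mulnS; apply: ideal_mul_min; first exact: ld_ideal (ideal_mul_ideal _ _).
by move=> a b Ja /IH; exact: ld_mul.
Qed.

(* Mumford's comparison: in degrees [i n <= k < (i + 1) n] the leading ideal of
   [J ^ n] contains the [n]-th power of that of [J] in degree [i]. *)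
Lemma len_pow_ld J p n : is_ideal J -> J (pXn R p) ->
    flen setT (ideal_pow J n) -> (forall i, flen setT (ideal_pow (ld J i) n)) ->
  (len setT (ideal_pow J n) <=
     n * \sum_(i < p) len setT (ideal_pow (ld J i) n))%N.
Proof.
move=> Ji Jp flJ fll; have Jni := @ideal_pow_ideal S J n.
have Jnp : ideal_pow J n (pXn R (p * n)%N).
  elim: n {flJ fll Jni} => [//|n IH]; rewrite mulnS pXnD; exact: ideal_mul_mem.
rewrite (len_ld Jni Jnp flJ).2.
elim: p {Jp Jnp} => [|p IH]; first by rewrite mul0n !big_ord0.
rewrite big_ord_recr /= mulnDr mulSn addnC big_split_ord /=.
apply: leq_add; first exact: IH.
apply: (@leq_trans (\sum_(i < n) len setT (ideal_pow (ld J p) n))%N); last first.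
  by rewrite sum_nat_const card_ord.
apply: leq_sum => i _.
apply: len_antitone => //; [exact: ideal_pow_ideal|exact: ld_ideal|].
by apply: subset_trans (@ld_pow J p n) _; apply: ld_sub => //; exact: leq_addr.
Qed.

End LeadingIdeals.

Section LechMumford.
Variable K : realType.

Lemma noetherian_evp (R : comNzRingType) (I : set R) : noetherian R -> is_ideal I ->
    flen setT I ->
  (forall n, flen setT (ideal_pow I n)) /\
  evp (fun n => (len setT (ideal_pow I n))%:R : K).
Proof.
move=> noeR /(noetherian_span noeR)[z ->] fl; split=> [n|].
  by case: (flen_pow fl n).
exact: evp_len_pow.
Qed.

Definition hs_ratio (R : comNzRingType) (d : nat) (I : set R) (n : nat) : K :=
  d`!%:R * (len setT (ideal_pow I n))%:R / n%:R ^+ d.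

Lemma hs_ratio_ge0 (R : comNzRingType) d (I : set R) n : 0 <= hs_ratio d I n.
Proof. by rewrite /hs_ratio divr_ge0// ?mulr_ge0// exprn_ge0. Qed.

Lemma hs_ratio_cvg (R : comNzRingType) d (I : set R) : noetherian R -> is_ideal I ->
  flen setT I -> cvgn (fun n => (hs_ratio d I n)%:E).
Proof.
move=> noeR Ii fl; have [_ ev] := noetherian_evp noeR Ii fl.
have [||l ul] := @evp_cvg K (fun n => d`!%:R * (len setT (ideal_pow I n))%:R) d _.
- apply: (@evp_eq _ _ (fun n => \sum_(i < d`!) (len setT (ideal_pow I n))%:R) 0%N).
    by move=> n _; rewrite sumr_const card_ord mulr_natl.
  exact: (@evp_sum_ord K d`! (fun _ n => (len setT (ideal_pow I n))%:R)).
- by move=> n; rewrite mulr_ge0.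
by apply/cvg_ex; exists l.
Qed.

Lemma hs_multiplicityE (R : comNzRingType) d (I : set R) : noetherian R -> is_ideal I ->
    flen setT I -> has_krull_dim R d ->
  hs_multiplicity K I = limn (fun n => (hs_ratio d I n)%:E).
Proof.
move=> noeR Ii fl dimR; rewrite /hs_multiplicity (krull_dimE dimR).
suff e n : (d`!%:R%:E * quot_length K setT (ideal_pow I n) / (n%:R ^+ d)%:E)%E =
    (hs_ratio d I n)%:E by under eq_fun do rewrite e.
have [fln _] := noetherian_evp noeR Ii fl.
rewrite quot_lengthE//; last exact: ideal_pow_ideal.
(* At [n = 0] the denominator may vanish, but the zeroth power is the whole ring, so both sides are
   0. *)
case: n => [|n].
  rewrite /hs_ratio len_refl//; by rewrite mulr0 mul0r mule0 mul0e.
by rewrite -EFinM inver expf_eq0 pnatr_eq0 andbF.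
Qed.

Lemma hs_multiplicity_ge0 (R : comNzRingType) d (I : set R) : noetherian R -> is_ideal I ->
  flen setT I -> has_krull_dim R d -> (0 <= hs_multiplicity K I)%E.
Proof.
move=> noeR Ii fl dimR; rewrite (hs_multiplicityE noeR Ii fl dimR).
apply: lime_ge; first exact: hs_ratio_cvg.
by apply: nearW => n; rewrite lee_fin hs_ratio_ge0.
Qed.

Lemma primary_len_gt0 (R : comNzRingType) (m I : set R) : noetherian R -> local_ring m ->
  m_primary m I -> (0 < len setT I)%N.
Proof.
move=> noeR locR Ip; have [Ii _] := Ip.
have I1 := m_primary_proper (locR.1) Ip.
apply: len_gt0 => //; last exact: flen_primary noeR locR Ip.
by split=> // h; apply: I1; exact: h.
Qed.

Lemma c_LM_ratioE (R : comNzRingType) d (m I : set R) : noetherian R -> local_ring m ->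
    has_krull_dim R d -> m_primary m I ->
  (hs_multiplicity K I / ((krull_dim R)`!%:R%:E * quot_length K setT I) =
   hs_multiplicity K I * ((d`! * len setT I)%N%:R^-1)%:E)%E.
Proof.
move=> noeR locR dimR Ip; have fl := flen_primary noeR locR Ip; have [Ii _] := Ip.
rewrite (krull_dimE dimR) quot_lengthE// -EFinM -natrM inver pnatr_eq0 ifF//.
apply/negbTE; rewrite muln_eq0 negb_or -!lt0n fact_gt0/=.
exact: primary_len_gt0 Ip.
Qed.

(** Colengths of [m]-primary ideals are positive and finite, so denominators can be cleared;
    uniqueness of the maximal ideal removes it from the supremum. *)
Lemma c_LM_le (R : comNzRingType) d (m : set R) (c : \bar K) : noetherian R ->
    local_ring m -> has_krull_dim R d ->
  (c_LM R K <= c)%E <-> forall I, m_primary m I ->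
    (hs_multiplicity K I <= c * (d`! * len setT I)%N%:R%:E)%E.
Proof.
move=> noeR locR dimR.
have dl I : m_primary m I -> (0 : K) < (d`! * len setT I)%N%:R.
  by move=> Ip; rewrite ltr0n muln_gt0 fact_gt0 (primary_len_gt0 noeR locR Ip).
split=> [h I Ip|h].
  rewrite -lee_pdivrMr ?dl// -(c_LM_ratioE noeR locR dimR Ip).
  by apply: le_trans h; apply: ereal_sup_ubound; exists I => //; exists m.
apply: ge_ereal_sup => _ [I [m' [locR' Ip]] <-].
have mm : m' = m by apply: locR.2; exact: locR'.1.
rewrite mm in Ip.
by rewrite (c_LM_ratioE noeR locR dimR Ip) lee_pdivrMr ?dl//; exact: h.
Qed.

Lemma c_LM_ge0 (R : comNzRingType) d (m : set R) : noetherian R ->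
  local_ring m -> has_krull_dim R d -> (0 <= c_LM R K)%E.
Proof.
move=> noeR locR dimR.
have [[mi m1 mmax] _] := locR.
have mp : m_primary m m.
  by apply: (@m_primary_of_pow R m m 1 noeR locR mi m1); rewrite ideal_pow1.
have fl := flen_primary noeR locR mp.
apply: (@le_trans _ _ (hs_multiplicity K m / ((krull_dim R)`!%:R%:E * quot_length K setT m))%E).
  rewrite (c_LM_ratioE noeR locR dimR mp) mule_ge0//.
  exact: hs_multiplicity_ge0 dimR.
by apply: ereal_sup_ubound; exists m => //; exists m.
Qed.

Lemma c_LM_pseries_le (R : comNzRingType) d (m : set R) : noetherian R ->
    local_ring m -> has_krull_dim R d ->
  (c_LM (Defs.pseries R) K <= c_LM R K)%E.
Proof.
move=> noeR locR dimR.
have noeS := pseries_noetherian noeR; have locS := pseries_local noeR locR.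
have dimS := pseries_krull_dim noeR locR dimR.
have cle := (c_LM_le (c_LM R K) noeR locR dimR).1 (lexx _).
have c_ge0 := c_LM_ge0 noeR locR dimR.
apply/(c_LM_le _ noeS locS dimS) => J Jp.
have Lpos := primary_len_gt0 noeS locS Jp.
case E : (c_LM R K) => [c| |]; last 2 first.
- by rewrite gt0_mulye ?leey// lte_fin ltr0n muln_gt0 fact_gt0.
- by rewrite E in c_ge0.
rewrite E in cle c_ge0.
have [Ji radJ] := Jp; have flJ := flen_primary noeS locS Jp.
have [p Jpp] : exists p, J (pXn R p).
  have : [set f : Defs.pseries R | m (f 0%N)] (pXn R 1%N).
    by rewrite /= /pXn; apply: ideal0; case: locR.1.
  rewrite -radJ => -[p Jp1]; exists p; move: Jp1; rewrite (_ : pXn R 1%N ^+ p = pXn R p)//.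
  by elim: p => [|p IH]; rewrite ?expr0// exprS IH -pXnD.
have [fll lenJ] := len_ld Ji Jpp flJ.
have ldi i := ld_ideal i Ji.
have ldn i := noetherian_evp noeR (ldi i) (fll i).
have [flJn _] := noetherian_evp noeS Ji flJ.
(* A leading ideal is either the whole ring, with ratio 0, or [m]-primary; in the second case
   finiteness of [c] forces its multiplicity to be finite. *)
have ei i : exists2 r : K, hs_ratio d (ld J i) @ \oo --> r &
    r <= c * (d`! * len setT (ld J i))%N%:R.
  have [l1|l1] := pselect (ld J i 1).
    have lT := ideal1 (ldi i) l1; exists 0.
      have -> : hs_ratio d (ld J i) = fun=> 0; last exact: cvg_cst.
      by apply/funext => n; rewrite /hs_ratio lT ideal_pow_setT len_refl// mulr0 mul0r.
    by rewrite mulr_ge0// -lee_fin.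
  have ldp : m_primary m (ld J i).
    have [r mJ] := m_primary_pow noeS locS Jp.
    split=> //; apply/seteqP; split=> x.
      move=> [n /(proper_sub_maximal noeR locR (ldi i) l1)].
      by apply: prime_exp; exact: maximal_prime locR.1.
    move=> mx; have : radical J (pC x) by rewrite radJ.
    move=> [n Jx]; exists n; apply: (ld_sub Ji (leq0n i)).
    by exists (pC (x ^+ n)) => //; rewrite pXn0 mul1r -pCX.
  have := cle _ ldp; rewrite (hs_multiplicityE noeR (ldi i) (fll i) dimR) -EFinM.
  have cv := hs_ratio_cvg (d := d) noeR (ldi i) (fll i).
  have l0 : (0 <= limn (fun n => (hs_ratio d (ld J i) n)%:E))%E.
    by apply: lime_ge => //; apply: nearW => n; rewrite lee_fin hs_ratio_ge0.
  have cvl : (fun n => (hs_ratio d (ld J i) n)%:E) @ \oo -->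
      limn (fun n => (hs_ratio d (ld J i) n)%:E) := cv.
  move: cvl l0; case: (limn _) => [r| |]// cvl _ rc.
  by exists r; [have /fine_cvgP[_] := cvl|rewrite -lee_fin].
have /choice[r rP] i : exists r : K, hs_ratio d (ld J i) @ \oo --> r /\
    r <= c * (d`! * len setT (ld J i))%N%:R.
  by have [r ? ?] := ei i; exists r.
have sumcv : (fun n => d.+1%:R * \sum_(i < p) hs_ratio d (ld J i) n) @ \oo -->
    d.+1%:R * \sum_(i < p) r i.
  by apply: cvgM; [exact: cvg_cst|apply: (@cvgn_sum K p (fun i => hs_ratio d (ld J i)) r) => i; case: (rP i)].
apply: (@le_trans _ _ (d.+1%:R * \sum_(i < p) r i)%:E); last first.
  rewrite -EFinM lee_fin factS lenJ -mulnA natrM mulrCA ler_wpM2l//.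
  rewrite big_distrr natr_sum mulr_sumr /=.
  by apply: ler_sum => i _; case: (rP i).
rewrite (hs_multiplicityE noeS Ji flJ dimS).
have Esumcv : (fun n => (d.+1%:R * \sum_(i < p) hs_ratio d (ld J i) n)%:E) @ \oo -->
    (d.+1%:R * \sum_(i < p) r i)%:E.
  by apply: cvg_EFin; [exact: nearW|exact: sumcv].
rewrite -(cvg_lim _ Esumcv)//; apply: lee_lim.
- exact: hs_ratio_cvg.
- by apply/cvg_ex; eexists; exact: Esumcv.
(* The factor [n] of [len_pow_ld] lowers [n^(d + 1)] to [n^d], and the quotient of the factorials is
   the [d + 1] in front of the sum. *)
exists 1%N => // n /= n_gt0; rewrite lee_fin /hs_ratio.
have n0 : (0 : K) < n%:R by rewrite ltr0n.
rewrite -mulr_suml -mulr_sumr exprS invfM factS natrM -!mulrA ler_wpM2l// ler_wpM2l//.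
rewrite mulrA ler_wpM2r ?invr_ge0 ?exprn_ge0 ?ler0n//.
rewrite ler_pdivrMr// mulrC -natr_sum -natrM ler_nat.
apply: len_pow_ld => // i; by have [] := ldn i.
Qed.

End LechMumford.


(** * Graded families *)

(** An elementwise form of graded families, including index 0; [gext] and slowing down both preserve
    this shape. *)
Definition primary_family (R : comNzRingType) (m : set R) (F : nat -> set R) :=
  [/\ F 0%N = setT, forall k, is_ideal (F k),
      forall k l, (k <= l)%N -> F l `<=` F k,
      forall k l a b, F k a -> F l b -> F (k + l)%N (a * b)
    & forall k, (0 < k)%N -> m_primary m (F k)].

Lemma primary_of_primes (R : comNzRingType) (m J : set R) : noetherian R ->
    local_ring m -> is_ideal J -> ~ J 1 ->
    (forall P, is_prime_ideal P -> J `<=` P -> m `<=` P) ->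
  m_primary m J.
Proof.
move=> noeR locR Ji J1 h; have [Ps [Psp PsJ]] := prime_decomposition noeR Ji.
apply: (m_primary_of_pow (r := size Ps) noeR locR Ji J1).
rewrite -foldr_mul_pow// => P /Psp[Pp JP].
by apply/seteqP; split; [exact: (prime_proper_sub noeR locR)|exact: h].
Qed.

Lemma primary_family_pow (R : comNzRingType) (m : set R) F k n : primary_family m F ->
  ideal_pow (F k) n `<=` F (k * n)%N.
Proof.
move=> [F0 Fi _ FM _]; elim: n => [|n IH]; first by rewrite muln0 F0.
rewrite ideal_powS mulnS; apply: ideal_mul_min => // a b Fa /IH; exact: FM.
Qed.

Lemma primary_family_flen (R : comNzRingType) (m : set R) F k : noetherian R ->
  local_ring m -> primary_family m F -> flen setT (F k).
Proof.
move=> noeR locR [F0 Fi _ _ Fp]; case: k => [|k]; last exact: flen_primary (Fp _ _).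
rewrite F0; have [[mi _ _] _] := locR.
by apply: flen_sub (flen_maximal locR.1).
Qed.

(* The ideals [\sum_i F (k - i) * T ^ i]. *)
Definition gext (R : comNzRingType) (F : nat -> set R) (k : nat) : set (Defs.pseries R) :=
  [set f | forall i, F (k - i)%N (f i)].

Lemma gext_family (R : comNzRingType) (m : set R) F : noetherian R -> local_ring m ->
  primary_family m F -> primary_family [set f : Defs.pseries R | m (f 0%N)] (gext F).
Proof.
move=> noeR locR [F0 Fi Fd FM Fp].
have noeS := pseries_noetherian noeR; have locS := pseries_local noeR locR.
have Ei k : is_ideal (gext F k).
  split=> [i|f g Ef Eg i|r f Ef i]; first exact: ideal0.
    exact: idealD.
  rewrite pcoefM; apply: ideal_sum => // j; apply: idealMl => //.
  by apply: Fd (Ef _); have := ltn_ord j; lia.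
split=> //.
- by apply/seteqP; split=> // f _ i; rewrite sub0n F0.
- by move=> k l kl f Ef i; apply: Fd (Ef i); exact: leq_sub2r.
- move=> k l f g Ef Eg i; rewrite pcoefM; apply: ideal_sum => // j.
  (* With truncated subtraction, [(k - j) + (l - (i - j))] may exceed [(k + l) - i]; that the family
     is decreasing covers this. *)
  by apply: Fd (FM _ _ _ _ (Ef _) (Eg _)); have := ltn_ord j; lia.
move=> k k_gt0; have [Fki radk] := Fp _ k_gt0.
apply: (primary_of_primes noeS locS (Ei k)).
  move=> /(_ 0%N); rewrite subn0 pcoef1.
  exact: m_primary_proper locR.1 (Fp _ k_gt0).
move=> P Pp EP f mf; have [Pi _ _] := Pp.
(* A prime containing [gext F k] contains [T], as [T^k] has its only nonzero coefficient in [F 0],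
   and every constant of [m], as a power of it is in [F k]. *)
have PX : P (pXn R 1%N).
  apply: (prime_exp (n := k) Pp); apply: EP => i.
  have -> : pXn R 1%N ^+ k = pXn R k.
    by elim: (k) => [|l IH]; rewrite ?expr0// exprS IH -pXnD.
  rewrite /pXn; case: eqVneq => [->|_]; last exact: ideal0.
  by rewrite subnn F0.
have PC : P (pC (f 0%N)).
  have : radical (F k) (f 0%N) by rewrite radk.
  move=> [n Fn]; apply: (prime_exp (n := n) Pp); apply: EP => i.
  rewrite pCX /pC; case: eqVneq => [->|_]; last exact: ideal0.
  by rewrite subn0.
rewrite -(subrK (pC (f 0%N)) f); apply: idealD => //.
rewrite (@pdrop1K _ (f - pC (f 0%N))); last by rewrite pcoefB /pC subrr.
exact: idealMr.
Qed.

Lemma ld_gext (R : comNzRingType) (F : nat -> set R) k i :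
  (forall k, is_ideal (F k)) -> ld (gext F k) i = F (k - i)%N.
Proof.
move=> Fi; apply/seteqP; split=> c.
  by move=> [f <- /(_ i)]; rewrite pcoefXnM ltnn subnn.
move=> Fc; exists (pC c) => // l; rewrite pcoefXnM.
case: ltnP => il; first exact: ideal0.
rewrite /pC; case: eqVneq => [e|_]; last exact: ideal0.
by have -> : l = i by lia.
Qed.

(** The leading ideals of [gext F k] in degrees 0 to [k - 1] are [F k], ..., [F 1], whence a sum
    from 1 to [k]. *)
Definition csum (u : nat -> nat) (k : nat) : nat := (\sum_(j < k) u j.+1)%N.

Lemma len_gext (R : comNzRingType) (m : set R) F k : noetherian R -> local_ring m ->
  primary_family m F ->
  len setT (gext F k) = csum (fun k => len setT (F k)) k.
Proof.
move=> noeR locR Ff; have Ef := gext_family noeR locR Ff.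
have noeS := pseries_noetherian noeR; have locS := pseries_local noeR locR.
have [F0 Fi _ _ _] := Ff; have [_ Ei _ _ _] := Ef.
have EX : gext F k (pXn R k).
  move=> i; rewrite /pXn; case: eqVneq => [->|_]; last exact: ideal0.
  by rewrite subnn F0.
rewrite (len_ld (Ei k) EX (primary_family_flen k noeS locS Ef)).2.
rewrite /csum -(big_mkord xpredT (fun i => len setT (ld (gext F k) i))).
rewrite big_nat_rev /= big_mkord; apply: eq_bigr => j _.
by rewrite ld_gext//; congr (len setT (F _)); have := ltn_ord j; lia.
Qed.

Fixpoint mgext (R : comNzRingType) (F : nat -> set R) (n : nat) :
    nat -> set (mpseries R n) :=
  match n return nat -> set (mpseries R n) with
  | 0%N => F
  | n'.+1 => @gext (mpseries R n') (@mgext R F n')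
  end.
Arguments mgext {R} F n _ _.

Lemma mgextP (R : comNzRingType) (m : set R) F d n : noetherian R -> local_ring m ->
    has_krull_dim R d -> primary_family m F ->
  exists M, [/\ @local_ring (mpseries R n) M, primary_family M (mgext F n) &
    forall k, len setT (mgext F n k) = iter n csum (fun k => len setT (F k)) k].
Proof.
move=> noeR locR dimR Ff; elim: n => [|n [M [locS Mf lenS]]]; first by exists m.
have [noeS _ _] := mpseries_local n noeR locR dimR.
eexists; split.
- exact: (@pseries_local (mpseries R n) _ noeS locS).
- exact: (@gext_family (mpseries R n) _ _ noeS locS).
- move=> k; rewrite /= (@len_gext (mpseries R n) _ _ k noeS locS Mf).
  by apply: eq_bigr => j _; rewrite lenS.
Qed.

(** The ceiling of [k / w], for positive [w]. *)
Definition cdiv (k w : nat) : nat := ((k + w.-1) %/ w)%N.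

Lemma ltn_cdiv i k w : (0 < w)%N -> (i < cdiv k w)%N = (i * w < k)%N.
Proof. by move=> w0; rewrite /cdiv leq_divRL// mulSn; apply/idP/idP; lia. Qed.

Lemma cdiv_le k w M : (0 < w)%N -> (cdiv k w <= M)%N = (k <= M * w)%N.
Proof. by move=> w0; rewrite leqNgt ltn_cdiv// -leqNgt. Qed.

Lemma cdiv_ge k w : (0 < w)%N -> (k <= cdiv k w * w)%N.
Proof. by move=> w0; rewrite -cdiv_le. Qed.

(* Slowing the family down by [w] amounts to giving the variables weight [1/w]. *)
Lemma refined_family (R : comNzRingType) (m : set R) F w : (0 < w)%N ->
  primary_family m F -> primary_family m (fun k => F (cdiv k w)).
Proof.
move=> w0 [F0 Fi Fd FM Fp]; split=> //.
- by rewrite (_ : cdiv 0 w = 0%N)//; apply/eqP; rewrite -leqn0 cdiv_le.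
- by move=> k l kl; apply: Fd; rewrite cdiv_le// (leq_trans kl)// cdiv_ge.
- move=> k l a b Fa Fb; apply: Fd (FM _ _ _ _ Fa Fb).
  by rewrite cdiv_le// mulnDl leq_add// cdiv_ge.
- by move=> k k0; apply: Fp; rewrite ltn_cdiv// mul0n.
Qed.

Lemma family_len_sum (R : comNzRingType) (m : set R) F k : noetherian R ->
  local_ring m -> primary_family m F ->
  len setT (F k) = (\sum_(i < k) len (F i) (F i.+1))%N.
Proof.
move=> noeR locR Ff; have [F0 Fi Fd _ _] := Ff.
elim: k => [|k IH]; first by rewrite big_ord0 F0 len_refl.
rewrite big_ord_recr /= -IH; apply: len_add => //; first exact: Fd.
exact: primary_family_flen noeR locR Ff.
Qed.

(** The iterated sums at [k] involve only arguments up to [k]. The restriction to [M] is needed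
    because a sum of finitely many steps follows the colengths only on a bounded range. *)
Lemma csum_le u v M : (forall k, (k <= M)%N -> (u k <= v k)%N) ->
  forall n k, (k <= M)%N -> (iter n csum u k <= iter n csum v k)%N.
Proof.
move=> uv; elim=> [|n IH] k kM; first exact: uv.
by apply: leq_sum => j _; apply: IH; rewrite (leq_trans _ kM).
Qed.

(** The number of [n]-tuples of naturals with sum less than [t]; it is the [n]-fold [csum] of the
    indicator of [t > 0]. *)
Definition simplex (n t : nat) : nat := if t is t'.+1 then 'C(t' + n, n) else 0.

Lemma csum_simplex n t : csum (simplex n) t = simplex n.+1 t.
Proof.
case: t => [|t]; first by rewrite /csum big_ord0.
rewrite /csum /=; elim: t => [|t IH]; first by rewrite big_ord1 !add0n !binn.
by rewrite big_ord_recr /= IH addSnnS [in RHS]addSn binS.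
Qed.

Lemma csum_shift u j k : u 0%N = 0%N -> csum (fun k => u (k - j)%N) k = csum u (k - j).
Proof.
move=> u0; elim: k => [|k IH]; first by rewrite sub0n /csum !big_ord0.
rewrite /csum big_ord_recr /= -/(csum (fun k => u (k - j)%N) k) IH.
have [kj|jk] := ltnP k j.
  have -> : (k.+1 - j = 0)%N by lia.
  have -> : (k - j = 0)%N by lia.
  by rewrite u0 addn0.
by rewrite subSn// /csum big_ord_recr.
Qed.

(** By linearity each step is treated alone: the step at [i * w] is a shifted indicator, and [csum]
    commutes with the shift because [simplex n] vanishes at 0. *)
Lemma iter_csum_steps (l : nat -> nat) M w n k :
  iter n csum (fun k => \sum_(i < M) l i * (i * w < k))%N k =
    (\sum_(i < M) l i * simplex n (k - i * w))%N.
Proof.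
elim: n k => [|n IH] k.
  apply: eq_bigr => i _; congr (_ * _)%N; rewrite -subn_gt0.
  by case: (k - i * w)%N => //= t; rewrite bin0.
rewrite iterS /csum; under eq_bigr => j _ do rewrite IH.
rewrite exchange_big /=; apply: eq_bigr => i _; rewrite -big_distrr /=; congr muln.
by rewrite -csum_simplex -(csum_shift _ (u := simplex n)).
Qed.

Lemma simplex_le n t : (n`! * simplex n t <= (t + n) ^ n)%N.
Proof.
case: t => [|t] /=; first by rewrite muln0.
rewrite mulnC bin_ffact ffact_prod.
apply: (@leq_trans (\prod_(i < n) (t.+1 + n))%N).
  by apply: leq_prod => i _; lia.
by rewrite prod_nat_const card_ord.
Qed.

Lemma len_refined_ext (R : comNzRingType) (m : set R) F d n N w : noetherian R ->
    local_ring m -> has_krull_dim R d -> primary_family m F -> (0 < w)%N ->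
  (n`! * len setT (mgext (fun k => F (cdiv k w)) n (N * w)) <=
     (w + n) ^ n * \sum_(i < N) len (F i) (F i.+1) * (N - i) ^ n)%N.
Proof.
move=> noeR locR dimR Ff w0; have F'f := refined_family w0 Ff.
have [M [_ _ ->]] := mgextP n noeR locR dimR F'f.
apply: (@leq_trans (n`! * \sum_(i < N) len (F i) (F i.+1) * simplex n (N * w - i * w))%N).
  rewrite leq_mul2l; apply/orP; right.
  rewrite -(iter_csum_steps (fun i => len (F i) (F i.+1))).
  apply: (csum_le (M := (N * w)%N)) => // k kN.
  rewrite (family_len_sum _ noeR locR Ff).
  rewrite -(subnKC (_ : cdiv k w <= N)%N) ?cdiv_le//.
  rewrite big_split_ord /=; apply: leq_trans (leq_addr _ _).
  by apply: leq_sum => i _; rewrite -ltn_cdiv// ltn_ord muln1.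
rewrite !big_distrr /=; apply: leq_sum => i _.
rewrite mulnCA [leqRHS]mulnCA leq_mul2l; apply/orP; right.
apply: leq_trans (simplex_le _ _) _; rewrite -expnMn -mulnBl.
(* As [N - i >= 1], the quantity [(N - i) w + n] is at most [(w + n) (N - i)]. *)
have := ltn_ord i => iN; have Ni : (0 < N - i)%N by rewrite subn_gt0.
by case: (n) => // n'; rewrite leq_exp2r// mulnDl mulnC leq_add2l leq_pmulr.
Qed.

(** By Pascal's rule each summation raises the lower index of the binomial by one, while the
    constant error gains at most a factor [k]; the gap of [d] degrees between them is kept. *)
Lemma csum_lower (K : realType) (u : nat -> nat) (a B : K) (d : nat) : 0 <= a -> 0 <= B ->
    (forall k, a * 'C(k, d)%:R - B <= (u k)%:R) ->
  forall n k, a * 'C(k, n + d)%:R - B * k%:R ^+ n <= (iter n csum u k)%:R.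
Proof.
move=> a0 B0 uP; elim=> [|n IH] k; first by rewrite expr0 mulr1.
apply: (@le_trans _ _ (\sum_(j < k) (a * 'C(j.+1, n + d)%:R - B * k%:R ^+ n))).
  rewrite sumrB -mulr_sumr; apply: lerB.
    rewrite ler_wpM2l// -natr_sum ler_nat.
    elim: k => [|k IHk]; first by rewrite big_ord0.
    rewrite addSn binS big_ord_recr /=; apply: leq_add; first by rewrite -addSn.
    exact: leq_bin2l.
  by rewrite sumr_const card_ord exprS -[leLHS]mulr_natl [leLHS]mulrCA lexx.
rewrite /= /csum natr_sum; apply: ler_sum => j _; apply: le_trans (IH _).
rewrite lerD2l lerN2 ler_wpM2l// lerXn2r ?nnegrE// ler_nat.
exact: ltn_ord.
Qed.


(** * The lower bound *)

Section LowerBound.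
Variable K : realType.

Lemma bin_lower (k D : nat) : ((k - D) ^ D <= D`! * 'C(k, D))%N.
Proof.
rewrite mulnC bin_ffact ffact_prod; apply: (@leq_trans (\prod_(i < D) (k - D))%N).
  by rewrite prod_nat_const card_ord.
by apply: leq_prod => i _; have := ltn_ord i; lia.
Qed.

Lemma bin_upper (k D : nat) : (D`! * 'C(k, D) <= k ^ D)%N.
Proof.
rewrite mulnC bin_ffact ffact_prod; apply: (@leq_trans (\prod_(i < D) k)%N).
  by apply: leq_prod => i _; exact: leq_subr.
by rewrite prod_nat_const card_ord.
Qed.

Lemma bernoulli_le (y : K) n : 0 <= y -> y <= 1 -> 1 - n%:R * y <= (1 - y) ^+ n.
Proof.
move=> y0 y1; elim: n => [|n IH]; first by rewrite mul0r subr0.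
rewrite exprS; apply: (@le_trans _ _ ((1 - y) * (1 - n%:R * y))).
  rewrite -subr_ge0 (_ : _ - _ = n%:R * y ^+ 2); first by rewrite mulr_ge0// exprn_ge0.
  by rewrite -natr1; ring.
by rewrite ler_wpM2l// subr_ge0.
Qed.

(* The family [mgext _ n] is graded, so its colength bounds below those of the
   powers of each of its members. *)
Lemma hs_refined_ge (R : comNzRingType) (m : set R) F d n N w (a B : K) :
    noetherian R -> local_ring m -> has_krull_dim R d -> (0 < d)%N ->
    primary_family m F -> (0 < w)%N -> (0 < N)%N -> 0 <= a -> 0 <= B ->
    (forall j, a / d`!%:R * j%:R ^+ d - B <= (len setT (F j))%:R) ->
  ((a * w%:R ^+ n * N%:R ^+ (n + d))%:E <=
     hs_multiplicity K (mgext (fun k => F (cdiv k w)) n (N * w)%N))%E.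
Proof.
move=> noeR locR dimR d0 Ff w0 N0 a0 B0 lb.
have F'f := refined_family w0 Ff.
have [M [locS Ef lenE]] := mgextP n noeR locR dimR F'f.
have [noeS _ dimS] := mpseries_local n noeR locR dimR.
set E := mgext _ n in Ef lenE *; set J := E _.
have [_ Ei _ _ _] := Ef.
have fl k := primary_family_flen k noeS locS Ef.
have wK : (0 : K) < w%:R by rewrite ltr0n.
pose a' := a / w%:R ^+ d.
have a'0 : 0 <= a' by rewrite divr_ge0// exprn_ge0.
have lb' k : a' * 'C(k, d)%:R - B <= (len setT (F (cdiv k w)))%:R.
  apply: le_trans (lb (cdiv k w)); rewrite lerD2r.
  apply: (@le_trans _ _ (a' * ((cdiv k w)%:R * w%:R) ^+ d / d`!%:R)).
    rewrite -mulrA ler_wpM2l// ler_pdivlMr ?ltr0n ?fact_gt0//.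
    rewrite -natrM -natrX -natrM ler_nat mulnC; apply: leq_trans (bin_upper _ _) _.
    by rewrite leq_exp2r// cdiv_ge.
  rewrite exprMn /a' le_eqVlt; apply/orP; left; apply/eqP; field.
  by rewrite pnatr_eq0 -lt0n fact_gt0 expf_neq0// lt0r_neq0.
have len_lb k : a' * 'C(k, n + d)%:R - B * k%:R ^+ n <= (len setT (E k))%:R.
  by rewrite lenE; exact: csum_lower.
rewrite (hs_multiplicityE K noeS (Ei _) (fl _) dimS).
have [flJ _] := noetherian_evp K noeS (Ei (N * w)%N) (fl _).
pose D := (n + d)%N; pose k0 := (N * w)%N.
(* A lower bound for the ratio at the power [t]. The main term uses that [k0 * t - D] is at least
   [k0 * (t - D)]; the error [B (k0 t)^n] over [t^(n + d)] is at most a multiple of [1 / t] because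
   [d >= 1]. *)
pose g t : K := a' * k0%:R ^+ D * ((t - D)%N%:R / t%:R) ^+ D - D`!%:R * B * k0%:R ^+ n * t%:R^-1.
have gcv : g @ \oo --> a' * k0%:R ^+ D * 1 ^+ D - D`!%:R * B * k0%:R ^+ n * 0.
  apply: cvgB; (apply: cvgM; first exact: cvg_cst); last exact: cvg_invn.
  by apply: cvgn_exp; exact: cvg_subn_div.
have -> : a * w%:R ^+ n * N%:R ^+ (n + d) =
    a' * k0%:R ^+ D * 1 ^+ D - D`!%:R * B * k0%:R ^+ n * 0.
  rewrite expr1n mulr1 mulr0 subr0 /a' /k0 natrM exprMn /D ![_ ^+ (n + d)]exprD.
  by field; rewrite expf_neq0// lt0r_neq0.
have Ecv : (fun t => (g t)%:E) @ \oo -->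
    (a' * k0%:R ^+ D * 1 ^+ D - D`!%:R * B * k0%:R ^+ n * 0)%:E.
  by apply: cvg_EFin; [exact: nearW|exact: gcv].
rewrite -(cvg_lim _ Ecv)//; apply: lee_lim.
- by apply/cvg_ex; eexists; exact: Ecv.
- by apply: hs_ratio_cvg.
exists 1%N => // t /= t0; rewrite lee_fin /hs_ratio -/D.
have tK : (0 : K) < t%:R by rewrite ltr0n.
rewrite ler_pdivlMr ?exprn_gt0//.
apply: (@le_trans _ _ (D`!%:R * (len setT (E (k0 * t)%N))%:R)); last first.
  rewrite ler_wpM2l// ler_nat; apply: len_antitone => //.
  - exact: ideal_pow_ideal.
  - exact: primary_family_pow Ef.
apply: (@le_trans _ _ (D`!%:R * (a' * 'C(k0 * t, D)%:R - B * (k0 * t)%N%:R ^+ n))); last first.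
  by rewrite ler_wpM2l//; exact: len_lb.
rewrite /g mulrBl mulrBr; apply: lerB.
  rewrite -[leLHS]mulrA -exprMn divfK ?lt0r_neq0// -mulrA [leRHS]mulrCA ler_wpM2l//.
  rewrite -exprMn -natrM -natrX -natrM ler_nat.
  apply: leq_trans (bin_lower _ _); rewrite -/D.
  case: (D) => // D'; rewrite leq_exp2r// mulnBr leq_sub2l//.
  by rewrite leq_pmull// muln_gt0 N0 w0.
rewrite natrM [(k0%:R * _) ^+ n]exprMn -!mulrA !ler_wpM2l ?exprn_ge0//.
rewrite ler_pdivlMl// -exprS ler_weXn2l ?ler1n//.
by rewrite /D -addn1 leq_add2l.
Qed.


(** The constant is tested on a single ideal, of index [N * w]: [hs_refined_ge] bounds its
    multiplicity below and [len_refined_ext] its colength above. *)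
Lemma c_LM_ext_ge (R : comNzRingType) (m : set R) F d n N w (a B r : K) :
    noetherian R -> local_ring m -> has_krull_dim R d -> (0 < d)%N ->
    primary_family m F -> (0 < w)%N -> (0 < N)%N -> 0 <= a -> 0 <= B ->
    (forall j, a / d`!%:R * j%:R ^+ d - B <= (len setT (F j))%:R) ->
    c_LM (mpseries R n) K = r%:E ->
  a * w%:R ^+ n * N%:R ^+ (n + d) * n`!%:R <= r * (n + d)`!%:R *
    ((w + n)%N%:R ^+ n * \sum_(i < N) (len (F i) (F i.+1))%:R * (N - i)%N%:R ^+ n).
Proof.
move=> noeR locR dimR d0 Ff w0 N0 a0 B0 lb cr.
have F'f := refined_family w0 Ff.
have [M [locS Ef _]] := mgextP n noeR locR dimR F'f.
have [noeS _ dimS] := mpseries_local n noeR locR dimR.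
have r0 : 0 <= r by rewrite -lee_fin -cr; exact: (c_LM_ge0 K noeS locS dimS).
have := (c_LM_le (c_LM (mpseries R n) K) noeS locS dimS).1 (lexx _) (mgext (fun k => F (cdiv k w)) n (N * w)%N).
have [_ _ _ _ Ep] := Ef.
move=> /(_ (Ep _ _)); rewrite muln_gt0 N0 w0 => /(_ isT).
rewrite cr -EFinM => /(le_trans (hs_refined_ge n noeR locR dimR d0 Ff w0 N0 a0 B0 lb)).
rewrite lee_fin => h; have := len_refined_ext n N noeR locR dimR Ff w0.
rewrite -(ler_nat K) !natrM natrX natr_sum => h2.
apply: (@le_trans _ _ (r * ((n + d)`! * len setT (mgext (fun k => F (cdiv k w)) n (N * w)%N))%N%:R * n`!%:R)).
  by rewrite ler_wpM2r.
rewrite natrM -!mulrA ler_wpM2l// ler_wpM2l// mulrC.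
apply: le_trans h2 _; rewrite ler_wpM2l ?exprn_ge0//.
by apply: ler_sum => i _; rewrite natrM natrX.
Qed.

Lemma sum_pow_le_exp (l : nat -> K) (N n : nat) (x : K) : (forall i, 0 <= l i) ->
    (0 < N)%N -> N%:R * x <= n%:R ->
  \sum_(i < N) l i * (N - i)%N%:R ^+ n <=
    N%:R ^+ n * \sum_(i < N) l i * expR (- (i%:R * x)).
Proof.
move=> l0 N0 Nx; rewrite mulr_sumr; apply: ler_sum => i _.
rewrite mulrCA ler_wpM2l//.
have NK : (0 : K) < N%:R by rewrite ltr0n.
have -> : (N - i)%N%:R = N%:R * (1 - i%:R / N%:R) :> K.
  by rewrite natrB ?(ltnW (ltn_ord i))//; field; rewrite lt0r_neq0.
rewrite exprMn ler_wpM2l ?exprn_ge0//.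
apply: (@le_trans _ _ (expR (- (i%:R / N%:R)) ^+ n)).
  rewrite lerXn2r ?nnegrE ?expR_ge0 ?expR_ge1Dx//.
  by rewrite subr_ge0 ler_pdivrMr// mul1r ler_nat ltnW.
rewrite -expRM_natl ler_expR mulrN lerN2 mulrCA ler_wpM2l//.
by rewrite ler_pdivlMr// mulrC.
Qed.

Lemma c_LM_ext_exp (R : comNzRingType) (m : set R) F d n N (a B r s x : K) :
    noetherian R -> local_ring m -> has_krull_dim R d -> (0 < d)%N ->
    primary_family m F -> (0 < n)%N -> (0 < N)%N -> 0 <= a -> 0 <= B ->
    (forall j, a / d`!%:R * j%:R ^+ d - B <= (len setT (F j))%:R) ->
    N%:R * x <= n%:R ->
    \sum_(i < N) (len (F i) (F i.+1))%:R * expR (- (i%:R * x)) <= s ->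
    c_LM (mpseries R n) K = r%:E ->
  a * (1 - n%:R^-1) * N%:R ^+ d <= r * s * (n + d)%N%:R ^+ d.
Proof.
move=> noeR locR dimR d0 Ff n0 N0 a0 B0 lb Nx ls cr.
have [noeS [M locS] dimS] := mpseries_local n noeR locR dimR.
have r0 : 0 <= r by rewrite -lee_fin -cr; exact: (c_LM_ge0 K noeS locS dimS).
(* With this [w], [n / (w + n)] is at most [1 / n^2], and Bernoulli's inequality gives
   [(w / (w + n))^n >= 1 - 1 / n]. *)
pose w := (n ^ 3)%N; have w0 : (0 < w)%N by rewrite expn_gt0 n0.
have h := c_LM_ext_ge noeR locR dimR d0 Ff w0 N0 a0 B0 lb cr.
have l0 i : (0 : K) <= (len (F i) (F i.+1))%:R by [].
have h2 := sum_pow_le_exp l0 N0 Nx.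
have NK : (0 : K) < N%:R by rewrite ltr0n.
have nK : (0 : K) < n%:R by rewrite ltr0n.
pose v : K := (w + n)%N%:R; have v0 : 0 < v by rewrite /v ltr0n addn_gt0 w0.
have vw : v ^+ n * (1 - n%:R^-1) <= w%:R ^+ n.
  have -> : (w%:R : K) = v * (1 - n%:R / v).
    by rewrite mulrBr mulr1 mulrCA divff ?lt0r_neq0// mulr1 /v natrD addrK.
  rewrite exprMn ler_wpM2l ?exprn_ge0 ?(ltW v0)//.
  have nv : n%:R / v <= (n%:R ^+ 2)^-1.
    rewrite ler_pdivrMr// ler_pdivlMl ?exprn_gt0// -natrX -natrM ler_nat.
    by rewrite /w -expnSr leq_addr.
  apply: le_trans (bernoulli_le _ _ _).
  - rewrite lerD2l lerN2; apply: (@le_trans _ _ (n%:R * (n%:R ^+ 2)^-1)).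
      by rewrite ler_wpM2l.
    by rewrite expr2 invfM mulrA divff ?mul1r// lt0r_neq0.
  - by rewrite divr_ge0// ltW.
  - by rewrite ler_pdivrMr// mul1r /v ler_nat leq_addl.
have fle : ((n + d)`! <= n`! * (n + d) ^ d)%N.
  rewrite -(ffact_fact (leq_addl n d)) addnK mulnC leq_mul2l; apply/orP; right.
  apply: (@leq_trans (\prod_(i < d) (n + d))%N).
    by rewrite ffact_prod; apply: leq_prod => i _; exact: leq_subr.
  by rewrite prod_nat_const card_ord.
have pos : 0 < v ^+ n * N%:R ^+ n * n`!%:R.
  by rewrite !mulr_gt0 ?exprn_gt0// ltr0n fact_gt0.
rewrite -(ler_pM2r pos).
apply: (@le_trans _ _ (a * w%:R ^+ n * N%:R ^+ (n + d) * n`!%:R)).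
  have -> : a * (1 - n%:R^-1) * N%:R ^+ d * (v ^+ n * N%:R ^+ n * n`!%:R) =
      a * (v ^+ n * (1 - n%:R^-1)) * N%:R ^+ (n + d) * n`!%:R by rewrite exprD; ring.
  rewrite ler_wpM2r ?ler0n// ler_wpM2r ?exprn_ge0 ?ler0n//.
  exact: (ler_wpM2l a0 vw).
apply: (le_trans h).
apply: (@le_trans _ _ (r * (n`! * (n + d) ^ d)%N%:R * (v ^+ n * (N%:R ^+ n * s)))).
  apply: ler_pM => //.
  - by rewrite mulr_ge0.
  - rewrite mulr_ge0 ?exprn_ge0//; apply: sumr_ge0 => i _.
    by rewrite mulr_ge0// exprn_ge0.
  - by rewrite ler_wpM2l// ler_nat.
  - rewrite ler_wpM2l ?exprn_ge0//; apply: (le_trans h2).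
    by rewrite ler_wpM2l// exprn_ge0// ltW.
by rewrite natrM natrX le_eqVlt; apply/orP; left; apply/eqP; ring.
Qed.

(** The slack [(A - a) n^d / d!] eventually dominates the error of order [n^(d - 1)]; the remaining
    finitely many indices are absorbed by [B]. *)
Lemma bigO_lower (u : nat -> K) (A a : K) d : (0 < d)%N -> a < A -> 0 <= a ->
    (forall n, 0 <= u n) ->
    u = (fun n : nat => A / d`!%:R * n%:R ^+ d) +O_\oo (fun n : nat => n%:R ^+ d.-1 : K) ->
  exists2 B, 0 <= B & forall j, a / d`!%:R * j%:R ^+ d - B <= u j.
Proof.
move=> d0 aA a0 u0 /eqaddOP/= uO.
have [C [N0 NP]] : exists C : K, exists N0 : nat, forall n, (N0 <= n)%N ->
    `|u n - A / d`!%:R * n%:R ^+ d| <= C * `|n%:R ^+ d.-1|.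
  have [C [_ CP]] := uO; have [|N0 _ NP] := CP (C + 1); first by rewrite ltrDl.
  by exists (C + 1), N0 => n Nn; exact: NP.
have fK : (0 : K) < d`!%:R by rewrite ltr0n fact_gt0.
pose c := (A - a) / d`!%:R; have c0 : 0 < c by rewrite divr_gt0// subr_gt0.
(* From [j1] on the error bound is valid and [C j^(d - 1) <= c j^d]. Below [j1], the value of [B]
   chosen next makes the left side nonpositive. *)
pose j1 := maxn N0 (Num.truncn (`|C| / c)).+1.
exists (a / d`!%:R * j1%:R ^+ d) => [|j]; first by rewrite !mulr_ge0 ?exprn_ge0// invr_ge0 ltW.
have [jj|jj] := ltnP j j1.
  apply: le_trans (u0 j); rewrite subr_le0 ler_wpM2l ?(divr_ge0 a0 (ltW fK))//.
  by rewrite lerXn2r ?nnegrE// ler_nat ltnW.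
move: jj; rewrite geq_max => /andP[Nj Cj].
apply: (@le_trans _ _ (a / d`!%:R * j%:R ^+ d)).
  by rewrite lerBlDr lerDl !mulr_ge0 ?exprn_ge0// invr_ge0 ltW.
have := NP _ Nj; rewrite ler_norml => /andP[+ _].
rewrite lerBrDr => /(le_trans _); apply.
rewrite (ger0_norm (exprn_ge0 _ _))// -lerBlDr -mulrBl.
have -> : a / d`!%:R - A / d`!%:R = - c by rewrite /c -mulrBl -mulNr opprB.
rewrite mulNr lerN2 -[in leRHS](prednK d0) exprS mulrA ler_wpM2r ?exprn_ge0//.
apply: (le_trans (ler_norm C)); rewrite mulrC -ler_pdivrMr//.
have [|_ /ltW h] := andP (truncn_itv (_ : 0 <= `|C| / c)); first by rewrite divr_ge0// ltW.
by apply: (le_trans h); rewrite ler_nat.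
Qed.

End LowerBound.

Lemma graded_primary_family (R : comNzRingType) (m : set R) (I : nat -> set R) :
  graded_family I -> I 0%N = setT -> (forall n, (0 < n)%N -> m_primary m (I n)) ->
  primary_family m I.
Proof.
move=> [Idec Imul] I0 Ip; split=> //.
- by case=> [|k]; [rewrite I0; exact: idealT|case: (Ip k.+1 isT)].
- move=> k l /subnK <-; elim: (l - k)%N => // j IH; rewrite addSn.
  exact: subset_trans (Idec _) IH.
- by move=> k l a b Ia Ib; apply: Imul; exact: ideal_mul_mem.
Qed.

Lemma c_LM_infty_cvg (K : realType) (R : comNzRingType) (m : set R) d :
    noetherian R -> local_ring m -> has_krull_dim R d ->
  cvgn (fun n => c_LM (mpseries R n) K).
Proof.
move=> noeR locR dimR; apply: ereal_nonincreasing_is_cvgn.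
move=> n k /subnK <-; elim: (k - n)%N => // j IH; rewrite addSn; apply: le_trans IH.
have [noeS [M locS] dimS] := mpseries_local (j + n) noeR locR dimR.
exact: (@c_LM_pseries_le K (mpseries R (j + n)) _ M noeS locS dimS).
Qed.

Lemma c_LM_infty_ge0 (K : realType) (R : comNzRingType) (m : set R) d :
    noetherian R -> local_ring m -> has_krull_dim R d ->
  (0 <= c_LM_infty R K)%E.
Proof.
move=> noeR locR dimR; apply: lime_ge; first exact: (c_LM_infty_cvg noeR locR dimR).
apply: nearW => n; have [noeS [M locS] dimS] := mpseries_local n noeR locR dimR.
exact: (c_LM_ge0 K noeS locS dimS).
Qed.

Lemma c_LM_infty_ge (K : realType) (R : comNzRingType) (m : set R) d
    (F : nat -> set R) (a B s x : K) :
    noetherian R -> local_ring m -> has_krull_dim R d -> (0 < d)%N ->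
    primary_family m F -> 0 <= a -> 0 <= B -> 0 < x -> 0 < s ->
    (forall j, a / d`!%:R * j%:R ^+ d - B <= (len setT (F j))%:R) ->
    (forall N, \sum_(i < N) (len (F i) (F i.+1))%:R * expR (- (i%:R * x)) <= s) ->
  ((a / (x ^+ d * s))%:E <= c_LM_infty R K)%E.
Proof.
move=> noeR locR dimR d0 Ff a0 B0 x0 s0 lb ls.
(* For [N] the integer part of [n / x], [N / (n + d)] is at least [(n / x - 1) / (n + d)], which is
   the inner quotient after division by [n]; its limit is [1 / x]. *)
pose b n : K := a * (1 - n%:R^-1) * ((x^-1 - n%:R^-1) / (1 + d%:R * n%:R^-1)) ^+ d / s.
have bcv : b @ \oo --> a * (1 - 0) * ((x^-1 - 0) / (1 + d%:R * 0)) ^+ d / s.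
  have c0 : (fun n : nat => (n%:R : K)^-1) @ \oo --> (0 : K) := @cvg_invn K.
  have cc (c : K) : (fun=> c) @ \oo --> c by exact: cvg_cst.
  apply: cvgM; last exact: cvg_cst.
  apply: cvgM; first by apply: cvgM; [exact: cvg_cst|by apply: cvgB; [exact: cc|exact: c0]].
  apply: cvgn_exp; apply: cvgM; first by by apply: cvgB; [exact: cc|exact: c0].
  apply: cvgV; first by rewrite mulr0 addr0 oner_neq0.
  apply: cvgD; first exact: cvg_cst.
  by apply: cvgM; [exact: cc|exact: c0].
have -> : a / (x ^+ d * s) = a * (1 - 0) * ((x^-1 - 0) / (1 + d%:R * 0)) ^+ d / s.
  by rewrite mulr0 addr0 !subr0 mulr1 divr1 exprVn invfM mulrA.
have Ecv : (fun n => (b n)%:E) @ \oo -->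
    (a * (1 - 0) * ((x^-1 - 0) / (1 + d%:R * 0)) ^+ d / s)%:E.
  by apply: cvg_EFin; [exact: nearW|exact: bcv].
rewrite -(cvg_lim _ Ecv)//; apply: lee_lim.
- by apply/cvg_ex; eexists; exact: Ecv.
- exact: (c_LM_infty_cvg noeR locR dimR).
(* Restricting to [n > x] ensures that the integer part [N] of [n / x] is positive. *)
exists (Num.truncn x).+1 => // n /= xn.
have nx : x < n%:R.
  have /andP[_ h] := truncn_itv (ltW x0).
  by apply: (lt_le_trans h); rewrite ler_nat.
have n0 : (0 < n)%N by apply: leq_trans xn.
have nK : (0 : K) < n%:R by rewrite ltr0n.
have [noeS [M locS] dimS] := mpseries_local n noeR locR dimR.
have := c_LM_ge0 K noeS locS dimS.
case E : (c_LM _ _) => [r| |]// r0; last by rewrite leey.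
rewrite lee_fin in r0; rewrite lee_fin.
pose N := Num.truncn (n%:R / x).
have /andP[Nle Nlt] : (N%:R : K) <= n%:R / x < N.+1%:R.
  by apply: truncn_itv; rewrite divr_ge0// ltW.
have N0 : (0 < N)%N.
  rewrite lt0n; apply/negP => /eqP N0; move: Nlt; rewrite N0 ltr_pdivrMr// mul1r.
  by rewrite ltNge (ltW nx).
have Nx : N%:R * x <= n%:R by rewrite -ler_pdivlMr.
have := c_LM_ext_exp noeR locR dimR d0 Ff n0 N0 a0 B0 lb Nx (ls N) E => h.
have dnK : (0 : K) < (n + d)%N%:R by rewrite ltr0n addn_gt0 n0.
rewrite /b ler_pdivrMr//.
apply: (@le_trans _ _ (a * (1 - n%:R^-1) * (N%:R / (n + d)%N%:R) ^+ d)).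
  have n1 : 0 <= 1 - n%:R^-1 :> K by rewrite subr_ge0 invf_le1 ?ler1n.
  rewrite ler_wpM2l ?mulr_ge0//.
  have e : (x^-1 - n%:R^-1) / (1 + d%:R * n%:R^-1) = (n%:R / x - 1) / (n + d)%N%:R.
    rewrite natrD; field; rewrite !lt0r_neq0//= -natrD//.
  have q0 : 0 <= n%:R / x - 1 by rewrite subr_ge0 ler_pdivlMr// mul1r ltW.
  rewrite e lerXn2r ?nnegrE ?divr_ge0 ?ler0n//.
  by rewrite ler_pM2r ?invr_gt0// lerBlDr natr1 ltW.
rewrite exprMn exprVn mulrA ler_pdivrMr ?exprn_gt0//.
Qed.

Theorem proposition4p1p3 (K : realType) (R : comNzRingType) (m : set R)
    (d : nat) (I : nat -> set R) (A : K)
    (noethR : noetherian R) (localR : local_ring m)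
    (dimR : has_krull_dim R d) (d_ge1 : (1 <= d)%N)
    (gradedI : graded_family I) (I0 : I 0%N = setT)
    (primaryI : forall n, (0 < n)%N -> m_primary m (I n))
    (lengthI : (fun n : nat => fine (quot_length K setT (I n)))
       = (fun n : nat => A / d`!%:R * n%:R ^+ d)
         +O_\oo (fun n : nat => n%:R ^+ d.-1 : K))
    (x : K) (x_gt0 : 0 < x) :
  (A%:E / ((x ^+ d)%:E *
     \sum_(0 <= j <oo) (quot_length K (I j) (I j.+1)
                        * (expR (- (j%:R * x)))%:E))
   <= c_LM_infty R K)%E.
Proof.
have famI := graded_primary_family gradedI I0 primaryI.
have [_ Ii Idec _ _] := famI.
have flI n := primary_family_flen n noethR localR famI.
have flII n : flen (I n) (I n.+1) by apply: flen_sub (flI n.+1).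
have qE j : quot_length K (I j) (I j.+1) = (len (I j) (I j.+1))%:R%:E.
  by apply: quot_lengthE => //; exact: Idec.
have term_ge0 j : (0 <= quot_length K (I j) (I j.+1) * (expR (- (j%:R * x)))%:E)%E.
  by rewrite qE mule_ge0 ?lee_fin ?expR_ge0.
have c_ge0 := c_LM_infty_ge0 K noethR localR dimR.
have partial N : ((\sum_(i < N) (len (I i) (I i.+1))%:R * expR (- (i%:R * x)))%:E <=
    \sum_(0 <= j <oo) (quot_length K (I j) (I j.+1) * (expR (- (j%:R * x)))%:E))%E.
  apply: le_trans (nneseries_lim_ge N _); last by move=> j _ _; exact: term_ge0.
  rewrite big_mkord -sumEFin; apply: lee_sum => i _.
  by rewrite qE EFinM.
have xd : 0 < x ^+ d by rewrite exprn_gt0.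
(* If the series diverges, the left side is 0 because the inverse of [+oo] is 0; the value [-oo] is
   excluded by the empty partial sum. *)
case E : (\sum_(0 <= j <oo) _)%E partial => [s| |] partial; last 2 first.
- by rewrite gt0_muley ?lte_fin// invey mule0.
- by have := partial 0%N; rewrite big_ord0 leeNy_eq.
have s_gt0 : 0 < s.
  have := partial 1%N; rewrite big_ord1 lee_fin; apply: lt_le_trans.
  rewrite mulr_gt0 ?expR_gt0// ltr0n; apply: len_gt0 => //.
  rewrite I0; split=> // h; apply: (m_primary_proper localR.1 (primaryI 1%N isT)).
  exact: h.
rewrite -EFinM inver mulf_eq0 !gt_eqF//= -EFinM.
have [A_le0|A_gt0] := leP A 0.
  by apply: le_trans c_ge0; rewrite lee_fin mulr_le0_ge0// invr_ge0 mulr_ge0 ?ltW.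
case Ec : (c_LM_infty R K) c_ge0 => [c| |]// c_ge0; last by rewrite leey.
rewrite lee_fin in c_ge0.
rewrite lee_fin ler_pdivrMr ?mulr_gt0// leNgt; apply/negP => cA.
set T := c * (x ^+ d * s) in cA.
have T_ge0 : 0 <= T by rewrite !mulr_ge0// ltW.
(* The negated claim says [T < A]. The midpoint is below [A], as [bigO_lower] requires, and above
   [T], contradicting the bound that [c_LM_infty_ge] gives for [a]. *)
pose a := (A + T) / 2.
have Ta : T < a by rewrite /a; lra.
have aA : a < A by rewrite /a; lra.
have a_ge0 : 0 <= a := ltW (le_lt_trans T_ge0 Ta).
have lenI n : fine (quot_length K setT (I n)) = (len setT (I n))%:R.
  by rewrite quot_lengthE.
have [|B B_ge0 lb] := bigO_lower d_ge1 aA a_ge0 _ lengthI; first by move=> n; rewrite lenI.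
suff : a <= T by rewrite leNgt Ta.
rewrite /T -ler_pdivrMr ?mulr_gt0// -lee_fin -Ec.
apply: (c_LM_infty_ge noethR localR dimR d_ge1 famI a_ge0 B_ge0 x_gt0 s_gt0).
  by move=> j; rewrite -lenI.
by move=> N; rewrite -lee_fin.
Qed.
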